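(* Let $M_1,M_2,M_3$ be finite-dimensional von Neumann algebras with faithful positive functionals. Let $V_1\subseteq\mathcal B(L^2(M_1),L^2(M_2))$ and $V_2\subseteq\mathcal B(L^2(M_2),L^2(M_3))$ be quantum relations (from $M_1$ to $M_2$, and from $M_2$ to $M_3$, respectively), with associated completely positive adjacency operators $A_1\colon M_1\to M_2$ and $A_2\colon M_2\to M_3$, i.e. $V_i$ is the quantum relation associated to $A_i$ for $i=1,2$. Set $V=V_2\circ V_1\subseteq\mathcal B(L^2(M_1),L^2(M_3))$ and let $x=\Psi'(A_2\circ A_1)$, a positive operator in $M_3\otimes M_1^{op}$. Then $V$ is the quantum relation associated to $x$, that is, $$V=\{\nabla_{M_3}^{1/4}T\nabla_{M_1}^{1/4}:T\in\mathrm{Im}(x)\}.$$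
   Context: Inner products are linear in the second variable. For a finite-dimensional von Neumann algebra $M$ with faithful positive functional $\varphi_M$, let $L^2(M)$ be the GNS space with GNS map $\Lambda\colon M\to L^2(M)$ (a linear bijection); $M$ acts on $L^2(M)$ by left multiplication, and $M'$ is its commutant in $\mathcal B(L^2(M))$. Linear maps $A\colon M\to N$ are identified with operators in $\mathcal B(L^2(M),L^2(N))$ via $A\Lambda_M(x)=\Lambda_N(A(x))$. The Markov trace $\mathrm{Tr}_M$ is the restriction to $M$ of the canonical trace on $\mathcal B(L^2(M))$; $Q_M\in M$ is the positive invertible element with $\varphi_M(x)=\mathrm{Tr}_M(Q_Mx)$. Put $\sigma_z(x)=Q_M^{iz}xQ_M^{-iz}$ ($z\in\mathbb C$) and $\nabla_M\Lambda(x)=\Lambda(Q_MxQ_M^{-1})$. $M^{op}=\{x^{op}:x\in M\}$ is the opposite algebra. $\Psi'\colon\mathcal B(L^2(M),L^2(N))\to N\otimes M^{op}$ is the linear bijection with $\Psi'(|\Lambda(x)\rangle\langle\Lambda(y)|)=x\otimes(\sigma_{i/2}(y)^* )^{op}$, where $|\xi\rangle\langle\eta|\colon\zeta\mapsto(\eta|\zeta)\xi$. $N\otimes M^{op}$ acts on $\mathcal B(L^2(M),L^2(N))$ by $(a\otimes b^{op})T=aTb$, and $\mathrm{Im}(x)$ is the image of $x\in N\otimes M^{op}$ in this action. The quantum relation associated to $A\colon M\to N$ (or to $\Psi'(A)$) is $\{\nabla_N^{1/4}T\nabla_M^{1/4}:T\in\mathrm{Im}\,\Psi'(A)\}$; it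 is a quantum relation from $M$ to $N$, i.e. an $N'$-$M'$-bimodule in $\mathcal B(L^2(M),L^2(N))$. Composition is $V_2\circ V_1=\mathrm{lin}\{v_2v_1:v_i\in V_i\}$. *)

(* Defs.v *)
From HB Require Import structures.
From mathcomp Require Import all_boot all_order all_algebra.
From mathcomp Require Import spectral complex mxtens.
From mathcomp Require Import boolp classical_sets reals sequences exp trigo.

Set Implicit Arguments.
Unset Strict Implicit.
Unset Printing Implicit Defensive.

Import Order.TTheory GRing.Theory Num.Theory.
Local Open Scope ring_scope.
Local Open Scope sesquilinear_scope.
Local Open Scope complex_scope.

(** * Matrices over the complex numbers [R[i]] *)

Definition psdmx (R : realType) n (A : 'M[R[i]]_n) : Prop :=
  forall v : 'cV[R[i]]_n, 0 <= (v ^t* *m A *m v) 0 0.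

(** * Complex powers of operators *)

Definition expC (R : realType) (z : R[i]) : R[i] :=
  (expR (complex.Re z))%:C * (cos (complex.Im z) +i* sin (complex.Im z)).

(* Meaningful for [l > 0] only: the exponents below apply to operators with
   positive spectrum. *)
Definition cpow (R : realType) (l z : R[i]) : R[i] :=
  expC (z * (ln (complex.Re l))%:C).

(* Functional calculus: [T^z] acts as [l^z] on the [l]-eigenspace of [T].  This
   determines [T^z] whenever [T] is diagonalizable (see [opowE]). *)
Definition opow (R : realType) (V : vectType R[i]) (T : 'End(V)) (z : R[i]) :
    'End(V) :=
  xget 0 [set S : 'End(V) | forall (l : R[i]) (v : V),
                    T v = l *: v -> S v = cpow l z *: v]%classic.

Definition optrace (K : fieldType) (V : vectType K) (T : 'End(V)) : K :=
  \sum_i coord (vbasis {:V}) i (T (vbasis {:V})`_i).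

(** * Finite-dimensional von Neumann algebras *)

(* Unital *-subalgebras of B(H) for H = C^n; weak closure is automatic in
   finite dimension. *)
Record vnAlg (R : realType) := VnAlg {
  vn_dim : nat;
  vn_car :> {vspace 'M[R[i]]_vn_dim};
  vn_one : 1%:M \in vn_car;
  vn_mul : forall a b, a \in vn_car -> b \in vn_car -> a *m b \in vn_car;
  vn_adj : forall a, a \in vn_car -> a ^t* \in vn_car }.

Notation vn_elt M := (subvs_of (vn_car M)).

(* In these operations, [vsproj] only repackages a matrix that lies in [M]. *)
Section VnOperations.
Variables (R : realType) (M : vnAlg R).
Implicit Types a b : vn_elt M.

Definition vone : vn_elt M := vsproj M 1%:M.
Definition vmul a b : vn_elt M := vsproj M (vsval a *m vsval b).
Definition vstar a : vn_elt M := vsproj M ((vsval a) ^t*).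
Definition vinv a : vn_elt M := vsproj M (invmx (vsval a)).

End VnOperations.

Arguments vone {R} M.

Record wvnAlg (R : realType) := WvnAlg {
  wvn_alg :> vnAlg R;
  wvn_phi : {scalar vn_elt wvn_alg};
  wvn_phi_ge0 : forall x, 0 <= wvn_phi (vmul (vstar x) x);
  wvn_phi_faithful : forall x, wvn_phi (vmul (vstar x) x) = 0 -> x = 0 }.

(* As Lambda is a linear bijection, L2(M) is M itself with the inner product
   [ip]; a linear map from M to N and the operator it induces from L2(M) to
   L2(N) are the same object of type ['Hom(L2 M, L2 N)]. *)
Notation L2 M := (subvs_of (vn_car (wvn_alg M))).

Section GNS.
Variables (R : realType) (M : wvnAlg R).

Definition ip (x y : L2 M) : R[i] := wvn_phi M (vmul (vstar x) y).

Definition lmul (a : L2 M) : 'End(L2 M) := linfun (vmul a).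

Definition in_commutant (S : 'End(L2 M)) : Prop :=
  forall a : L2 M, (S \o lmul a)%VF = (lmul a \o S)%VF.

Definition markov_trace (x : L2 M) : R[i] := optrace (lmul x).

Definition density : L2 M :=
  xget 0 [set Q : L2 M | forall x : L2 M,
                    wvn_phi M x = markov_trace (vmul Q x)]%classic.

(* The power of [Q] is taken in B(L2(M)), where [M] acts faithfully; an operator
   [lmul a] yields [a] back by evaluation at the unit. *)
Definition density_pow (z : R[i]) : L2 M := opow (lmul density) z (vone M).

Definition modaut (z : R[i]) (x : L2 M) : L2 M :=
  vmul (vmul (density_pow ('i * z)) x) (density_pow (- ('i * z))).

Definition nabla : 'End(L2 M) :=
  linfun (fun x => vmul (vmul density x) (vinv density)).

End GNS.

Definition ketbra (R : realType) (M N : wvnAlg R) (x : L2 N) (y : L2 M) :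
    'Hom(L2 M, L2 N) :=
  linfun (fun z => ip y z *: x).

(** * The algebra N (x) M^op, the map Psi' and the action on B(L2(M), L2(N)) *)

(* M^op is realized as the *-algebra of the transposes [b^T], b in M, acting on
   C^m, and N (x) M^op as a *-algebra of Kronecker products acting on
   C^n (x) C^m. *)
Definition optens (R : realType) (N M : vnAlg R) :
    {vspace 'M[R[i]]_(vn_dim N * vn_dim M)} :=
  <<[seq a *t b^T | a <- vbasis N, b <- vbasis M]>>%VS.

Definition optensor (R : realType) (N M : vnAlg R)
    (a : vn_elt N) (b : vn_elt M) : subvs_of (optens N M) :=
  vsproj (optens N M) (vsval a *t (vsval b)^T).

Section QuantumRelations.
Variables (R : realType) (M N : wvnAlg R).

Definition Psi' : 'Hom('Hom(L2 M, L2 N), subvs_of (optens N M)) :=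
  xget 0 [set F : 'Hom('Hom(L2 M, L2 N), subvs_of (optens N M)) |
    forall (x : L2 N) (y : L2 M),
      F (ketbra x y) = optensor x (vstar (modaut ('i / 2) y))]%classic.

Definition optens_act :
    'Hom(subvs_of (optens N M), 'End('Hom(L2 M, L2 N))) :=
  xget 0 [set F : 'Hom(subvs_of (optens N M), 'End('Hom(L2 M, L2 N))) |
    forall (a : L2 N) (b : L2 M) (T : 'Hom(L2 M, L2 N)),
      F (optensor a b) T = (lmul a \o T \o lmul b)%VF]%classic.

Definition optens_im (x : subvs_of (optens N M)) :
    {vspace 'Hom(L2 M, L2 N)} :=
  limg (optens_act x).

Definition qrel_of (x : subvs_of (optens N M)) : {vspace 'Hom(L2 M, L2 N)} :=
  (linfun (fun T : 'Hom(L2 M, L2 N) =>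
      opow (nabla N) (4^-1)%R \o T \o opow (nabla M) (4^-1)%R)%VF
    @: optens_im x)%VS.

Definition quantum_relation (V : {vspace 'Hom(L2 M, L2 N)}) : Prop :=
  forall (S : 'End(L2 N)) (v : 'Hom(L2 M, L2 N)) (T : 'End(L2 M)),
    in_commutant S -> v \in V -> in_commutant T -> (S \o v \o T)%VF \in V.

(* [X] is an element of M_k(M), positive as an operator on the direct sum of k
   copies of the space on which [M] acts. *)
Definition completely_positive (A : 'Hom(L2 M, L2 N)) : Prop :=
  forall (k : nat) (X : 'M[L2 M]_k),
    psdmx (\mxblock_(i < k, j < k) vsval (X i j)) ->
    psdmx (\mxblock_(i < k, j < k) vsval (A (X i j))).

End QuantumRelations.

Arguments Psi' {R M N}.
Arguments optens_act {R M N}.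

Definition qrel_comp (R : realType) (M1 M2 M3 : wvnAlg R)
    (V2 : {vspace 'Hom(L2 M2, L2 M3)}) (V1 : {vspace 'Hom(L2 M1, L2 M2)}) :
    {vspace 'Hom(L2 M1, L2 M3)} :=
  <<[seq (v2 \o v1)%VF | v2 <- vbasis V2, v1 <- vbasis V1]>>%VS.

(** * The objects picked by [xget] have their defining properties *)

Local Close Scope complex_scope.

Lemma opowE (R : realType) (V : vectType R[i]) (T : 'End(V)) (z : R[i])
    n (e : n.-tuple V) (l : 'I_n -> R[i]) :
  basis_of {:V} e -> (forall i : 'I_n, T e`_i = l i *: e`_i) ->
  forall i : 'I_n, opow T z e`_i = cpow (l i) z *: e`_i.
Proof.
move=> eB Te i; rewrite /opow; set P := (X in xget 0 X).
have fe := basis_free eB.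
suff /(xgetPex 0) /(_ _ _ (Te i)) : exists S, P S by [].
exists (linfun (fun v => \sum_i (coord e i v * cpow (l i) z) *: e`_i)).
have lin : linear (fun v => \sum_i (coord e i v * cpow (l i) z) *: e`_i).
  move=> a u v; rewrite scaler_sumr -big_split; apply: eq_bigr => j _ /=.
  by rewrite linearP mulrDl scalerDl -!mulrA scalerA.
pose F := GRing.isLinear.Build _ _ _ _ _ lin.
pose G : {linear V -> V} := HB.pack (fun v => \sum_i (coord e i v * cpow (l i) z) *: e`_i) F.
move=> m v Tv; rewrite (lfunE G) /= [in RHS](coord_basis eB (memvf v)) scaler_sumr.
apply: eq_bigr => j _; rewrite scalerA.
have : coord e j (T v) = m * coord e j v by rewrite Tv linearZ.
rewrite {1}(coord_basis eB (memvf v)) linear_sum.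
rewrite (eq_bigr (fun k => (coord e k v * l k) *: e`_k)); last first.
  by move=> k _; rewrite linearZ /= Te scalerA.
rewrite coord_sum_free // => /eqP.
rewrite mulrC -subr_eq0 -mulrBl mulf_eq0 => /orP[|/eqP ->]; last first.
  by rewrite mul0r mulr0.
by rewrite subr_eq0 => /eqP ->; rewrite mulrC.
Qed.

Section VnTheory.
Variables (R : realType) (M : vnAlg R).
Implicit Types a b c : vn_elt M.

Lemma val_vone : vsval (vone M) = 1%:M.
Proof. by rewrite vsprojK ?vn_one. Qed.
Lemma val_vmul a b : vsval (vmul a b) = vsval a *m vsval b.
Proof. by rewrite vsprojK ?vn_mul ?subvsP. Qed.
Lemma val_vstar a : vsval (vstar a) = (vsval a) ^t*.
Proof. by rewrite vsprojK ?vn_adj ?subvsP. Qed.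

Lemma vmulA a b c : vmul a (vmul b c) = vmul (vmul a b) c.
Proof. by apply: val_inj; rewrite /= !val_vmul mulmxA. Qed.
Lemma vmul1 a : vmul a (vone M) = a.
Proof. by apply: val_inj; rewrite /= !val_vmul val_vone mulmx1. Qed.
Lemma vmul_linearl c : linear (fun a => vmul a c).
Proof.
by move=> k a b; apply: val_inj; rewrite /= !val_vmul /= mulmxDl -scalemxAl.
Qed.
Lemma vmul_linearr c : linear (vmul c).
Proof.
by move=> k a b; apply: val_inj; rewrite /= !val_vmul /= mulmxDr -scalemxAr.
Qed.
HB.instance Definition _ c := GRing.isLinear.Build _ _ _ _ (vmul c) (vmul_linearr c).
Lemma vstarK a : vstar (vstar a) = a.
Proof. by apply: val_inj; rewrite /= !val_vstar trmxCK. Qed.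
Lemma vstarM a b : vstar (vmul a b) = vmul (vstar b) (vstar a).
Proof. by apply: val_inj; rewrite /= !(val_vmul,val_vstar) trmx_mul map_mxM. Qed.
Lemma vstarD a b : vstar (a + b) = vstar a + vstar b.
Proof. by apply: val_inj; rewrite /= !val_vstar !linearD /= map_mxD. Qed.
Lemma vstarZ k a : vstar (k *: a) = k^* *: vstar a.
Proof. by apply: val_inj; rewrite /= !val_vstar !linearZ /= map_mxZ. Qed.
End VnTheory.

Section GNSTheory.
Variables (R : realType) (M : wvnAlg R).
Implicit Types a b c x y : L2 M.

Lemma lmulE a x : lmul a x = vmul a x.
Proof. by rewrite lfunE. Qed.

Lemma ip_linear x : linear (ip x : L2 M -> R[i]^o).
Proof. by move=> k a b; rewrite /ip linearP linearP. Qed.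
HB.instance Definition _ x := GRing.isLinear.Build _ _ _ _ (ip x : L2 M -> R[i]^o) (ip_linear x).

Lemma vmulDl x y z : vmul (x + y) z = vmul x z + vmul y z.
Proof. by apply: val_inj; rewrite /= !val_vmul /= mulmxDl. Qed.
Lemma vmulZl k x z : vmul (k *: x) z = k *: vmul x z.
Proof. by apply: val_inj; rewrite /= !val_vmul /= scalemxAl. Qed.
Lemma ipDl x y z : ip (x + y) z = ip x z + ip y z.
Proof. by rewrite /ip vstarD vmulDl linearD. Qed.
Lemma ipZl k x z : ip (k *: x) z = k^* * ip x z.
Proof. by rewrite /ip vstarZ vmulZl linearZ. Qed.
Lemma ipDr x y z : ip x (y + z) = ip x y + ip x z.
Proof. exact: (linearD (ip x : L2 M -> R[i]^o)). Qed.
Lemma ipZr k x z : ip x (k *: z) = k * ip x z.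
Proof. exact: (linearZ_LR (ip x : L2 M -> R[i]^o)). Qed.
Lemma ip_sumr x I (r : seq I) F : ip x (\sum_(i <- r) F i) = \sum_(i <- r) ip x (F i).
Proof. exact: (linear_sum (ip x : L2 M -> R[i]^o)). Qed.
Lemma ip_ge0 x : 0 <= ip x x.
Proof. exact: wvn_phi_ge0. Qed.
Lemma ip_eq0 x : ip x x = 0 -> x = 0.
Proof. exact: wvn_phi_faithful. Qed.

Lemma ip_conj x y : (ip x y)^* = ip y x.
Proof.
have := ger0_real (ip_ge0 (x + y)); have := ger0_real (ip_ge0 (x + 'i *: y)).
rewrite !ipDl !ipDr !ipZl !ipZr.
have rx := ger0_real (ip_ge0 x); have ry := ger0_real (ip_ge0 y).
have ryi : 'i^* * ('i * ip y y) \is Num.real.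
  by rewrite mulrA -normCKC normCi expr1n mul1r.
rewrite addrA rpredDr // -addrA rpredDl // => /CrealP h1.
rewrite addrA rpredDr // -addrA rpredDl // => /CrealP.
move: h1; set p := ip x y; set q := ip y x.
rewrite !rmorphD !rmorphM /= !conjCK conjCi.
have i0 : ('i : R[i]) != 0 by rewrite neq0Ci.
move=> h1 h2; have {}h1 : q^* - p^* = p - q.
  by apply: (mulfI i0); rewrite !mulrBr -mulNr addrC h1 mulNr.
suff : p^* *+ 2 = q *+ 2 by move/(pmulrnI (isT : (0 < 2)%N)).
rewrite !mulr2n.
have -> : p^* + p^* = (p^* + q^*) - (q^* - p^*) by rewrite opprB addrACA subrr addr0.
by rewrite h2 h1 opprB [p + q]addrC addrACA subrr addr0.
Qed.

Lemma onb_aux (s : seq (L2 M)) : exists f : seq (L2 M),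
  (forall g h, g \in f -> h \in f -> ip g h = (g == h)%:R) /\ uniq f /\
  (forall v, v \in s -> v = \sum_(g <- f) ip g v *: g).
Proof.
elim: s => [|v s [f [orf [uf sf]]]]; first by exists [::].
pose u := v - \sum_(g <- f) ip g v *: g.
have exf w : w \in f -> ip w (\sum_(g <- f) ip g v *: g) = ip w v.
  move=> wf; rewrite ip_sumr (bigD1_seq w) //= ipZr (orf w w) // eqxx mulr1.
  rewrite big_seq_cond big1 ?addr0 // => g /andP[gf gw].
  by rewrite ipZr (orf w g) // eq_sym (negbTE gw) mulr0.
have fu w : w \in f -> ip w u = 0.
  by move=> wf; rewrite /u -scaleN1r ipDr ipZr exf // mulN1r subrr.
have [u0|u0] := eqVneq u 0.
  exists f; split=> //; split=> // w; rewrite inE => /orP[/eqP ->|/sf //].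
  by apply/eqP; rewrite -subr_eq0 -/u u0.
have nu : 0 < ip u u.
  rewrite lt_neqAle ip_ge0 andbT eq_sym; apply: contra u0 => /eqP /ip_eq0 ->//.
pose c := (sqrtC (ip u u))^-1; have c0 : 0 < c by rewrite invr_gt0 sqrtC_gt0.
have cR : c^* = c by apply/CrealP/ger0_real/ltW.
have cc : c * (c * ip u u) = 1.
  by rewrite mulrA -expr2 exprVn sqrtCK mulVf // gt_eqF.
pose e := c *: u.
have fe w : w \in f -> ip w e = 0 by move=> wf; rewrite ipZr fu ?mulr0.
have ef w : w \in f -> ip e w = 0 by move=> wf; rewrite -ip_conj fe ?rmorph0.
have ee : ip e e = 1 by rewrite ipZl ipZr cR.
have nef : e \notin f by apply/negP => /fe; rewrite ee => /eqP; rewrite oner_eq0.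
exists (e :: f); split.
  move=> g h; rewrite !inE => /orP[/eqP ->|gf] /orP[/eqP ->|hf].
  - by rewrite ee eqxx.
  - by rewrite ef //; case: eqVneq nef hf => // -> /negP.
  - by rewrite fe //; case: eqVneq gf => // -> h'; rewrite h' in nef.
  - exact: orf.
split; first by rewrite /= nef.
move=> w; rewrite inE => /orP[/eqP ->|ws]; rewrite big_cons.
  have -> : ip e v = c * ip u u.
    rewrite {1}ipZl cR; congr (_ * _).
    have {1}-> : v = u + \sum_(g <- f) ip g v *: g by rewrite subrK.
    rewrite ipDr ip_sumr big_seq big1 ?addr0 // => g gf.
    by rewrite ipZr -(ip_conj g u) fu ?rmorph0 ?mulr0.
  by rewrite scalerA mulrAC -mulrA cc scale1r subrK.
suff -> : ip e w = 0 by rewrite scale0r add0r; exact: sf.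
rewrite (sf _ ws) ip_sumr big_seq big1 // => g gf.
by rewrite ipZr ef ?mulr0.
Qed.

Lemma onb : exists f : seq (L2 M),
  (forall g h, g \in f -> h \in f -> ip g h = (g == h)%:R) /\ uniq f /\
  (forall v, v = \sum_(g <- f) ip g v *: g).
Proof.
have [f [orf [uf sf]]] := onb_aux (vbasis {:L2 M}).
exists f; split=> //; split=> // v.
rewrite {1 2}(coord_vbasis (memvf v)).
under [RHS]eq_bigr => g _ do rewrite ip_sumr scaler_suml.
rewrite exchange_big; apply: eq_bigr => i _.
rewrite {1}(sf (vbasis {:L2 M})`_i); last by rewrite mem_nth // size_tuple.
by rewrite scaler_sumr; apply: eq_bigr => g _; rewrite ipZr scalerA.
Qed.

Lemma optraceE (f : seq (L2 M)) (T : 'End(L2 M)) :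
  (forall v, v = \sum_(g <- f) ip g v *: g) ->
  optrace T = \sum_(g <- f) ip g (T g).
Proof.
move=> sf; rewrite /optrace.
under eq_bigr => i _ do rewrite (sf (T _)) linear_sum.
rewrite exchange_big; apply: eq_bigr => g _ /=.
have -> : T g = T (\sum_i coord (vbasis {:L2 M}) i g *: (vbasis {:L2 M})`_i) by rewrite -coord_vbasis ?memvf.
rewrite linear_sum [in RHS]ip_sumr.
by apply: eq_bigr => i _; rewrite linearZ [in RHS]linearZ /= ipZr mulrC.
Qed.

Lemma ip_lmul a x y : ip x (vmul a y) = ip (vmul (vstar a) x) y.
Proof. by rewrite /ip vstarM vstarK !vmulA. Qed.

Lemma markov_trace_faithful a : markov_trace (vmul (vstar a) a) = 0 -> a = 0.
Proof.
have [f [_ [_ sf]]] := onb.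
rewrite /markov_trace (optraceE _ sf) => /eqP.
under eq_bigr => g _ do rewrite lmulE -vmulA ip_lmul vstarK.
rewrite psumr_eq0 => [/allP a0|g _]; last exact: ip_ge0.
rewrite -(vmul1 a) (sf (vone M)) linear_sum big_seq big1 // => g gf.
by rewrite linearZ; have /eqP/ip_eq0 /= -> := a0 g gf; rewrite scaler0.
Qed.

Lemma markov_trace_linear : linear (@markov_trace R M : _ -> R[i]^o).
Proof.
move=> k x y; rewrite /markov_trace /optrace scaler_sumr -big_split.
by apply: eq_bigr => i _; rewrite !lmulE vmulDl vmulZl linearP.
Qed.
HB.instance Definition _ := GRing.isLinear.Build _ _ _ _ (@markov_trace R M : _ -> R[i]^o) markov_trace_linear.

Lemma densityE x : wvn_phi M x = markov_trace (vmul (density M) x).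
Proof.
move: x; apply: (@xgetPex _ 0 [set Q : L2 M | forall x : L2 M,
                    wvn_phi M x = markov_trace (vmul Q x)]%classic) => /=.
pose e := vbasis {:L2 M}.
pose F (Q : L2 M) : 'rV[R[i]]_(\dim {:L2 M}) := \row_i markov_trace (vmul Q e`_i).
have linF : linear F.
  move=> k x y; apply/rowP => i; rewrite !mxE vmulDl vmulZl.
  exact: (linearP (@markov_trace R M : _ -> R[i]^o)).
pose LF : {linear _ -> _} := HB.pack F (GRing.isLinear.Build _ _ _ _ F linF).
have ext Q (h : {linear L2 M -> R[i]^o}) : (forall i : 'I_(\dim {:L2 M}), h e`_i = markov_trace (vmul Q e`_i)) ->
    forall x, h x = markov_trace (vmul Q x).
  move=> H x; rewrite (coord_vbasis (memvf x)).
  rewrite (linear_sum h) (linear_sum (vmul Q)).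
  rewrite [RHS](linear_sum (@markov_trace R M : {linear _ -> R[i]^o})).
  apply: eq_bigr => i _; rewrite linearZ_LR H (linearZ_LR (vmul Q)).
  by rewrite [RHS](linearZ_LR (@markov_trace R M : {linear _ -> R[i]^o})).
have inj : lker (linfun LF) == 0%VS.
  apply/lker0P => x y; rewrite !lfunE /= => /eqP.
  rewrite -subr_eq0 -(linearB LF) => /eqP; set d := x - y => Fd.
  have H : forall z, markov_trace (vmul d z) = 0.
    move=> z; have := @ext d (\0%R) _ z; move=> <- // i.
    by have /rowP/(_ i) := Fd; rewrite !mxE.
  apply/eqP; rewrite -subr_eq0 -/d -[d]vstarK; apply/eqP.
  rewrite (markov_trace_faithful (a := vstar d)) ?vstarK ?H //.
  by apply: val_inj; rewrite /= val_vstar !linear0 map_mx0.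
have /eqP sur : limg (linfun LF) == fullv.
  rewrite eqEdim subvf /= limg_dim_eq ?(eqP inj) ?capv0 //.
  by rewrite dimvf /dim /= mul1n.
have : \row_i wvn_phi M e`_i \in limg (linfun LF) by rewrite sur memvf.
case/memv_imgP => Q _; rewrite lfunE /= => /rowP HQ; exists Q.
by apply: ext => i; have := HQ i; rewrite !mxE.
Qed.

End GNSTheory.

Lemma linfunE (K : fieldType) (U V : vectType K) (F : U -> V) :
  linear F -> linfun F =1 F.
Proof.
move=> lF x; pose LF : {linear U -> V} := HB.pack F (GRing.isLinear.Build _ _ _ _ F lF).
exact: (lfunE LF).
Qed.

Section QuantumRelationTheory.
Variables (R : realType) (M N : wvnAlg R).

Lemma ketbraE (x : L2 N) (y z : L2 M) : ketbra x y z = ip y z *: x.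
Proof.
apply: (linfunE (F := fun z => ip y z *: x)) => k u v.
by rewrite ipDr ipZr scalerDl scalerA.
Qed.

Lemma optensor_val (a : L2 N) (b : L2 M) :
  vsval (optensor a b) = vsval a *t (vsval b)^T.
Proof.
rewrite vsprojK // {1}(coord_vbasis (subvsP a)) {1}(coord_vbasis (subvsP b)).
rewrite !linear_sum /=.
have tsl (I : Type) (r : seq I) (A : I -> 'M[R[i]]_(vn_dim N)) (B : 'M[R[i]]_(vn_dim M)) :
   (\sum_(i <- r) A i) *t B = \sum_(i <- r) (A i *t B).
  by apply/matrixP => i j; rewrite !(mxE, summxE) mulr_suml; apply: eq_bigr => k _; rewrite mxE.
have tsr (I : Type) (r : seq I) (B : I -> 'M[R[i]]_(vn_dim M)) (A : 'M[R[i]]_(vn_dim N)) :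
   A *t (\sum_(i <- r) B i) = \sum_(i <- r) (A *t B i).
  by apply/matrixP => i j; rewrite !(mxE, summxE) mulr_sumr; apply: eq_bigr => k _; rewrite mxE.
rewrite tsl memv_suml // => i _; rewrite tsr memv_suml // => j _.
have -> (A : 'M[R[i]]_(vn_dim N)) (B : 'M[R[i]]_(vn_dim M)) k l :
   (k *: A) *t (l *: B)^T = (k * l) *: (A *t B^T).
  by apply/matrixP => i1 j1; rewrite !mxE mulrACA.
rewrite memvZ // memv_span //; apply: allpairs_f; by rewrite mem_nth // size_tuple.
Qed.

Lemma optensor_linearl (b : L2 M) : linear (fun a : L2 N => optensor a b).
Proof.
move=> k x y; apply: val_inj; rewrite /= !optensor_val /=.
by apply/matrixP => i j; rewrite !mxE mulrDl mulrA.
Qed.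
Lemma optensor_linearr (a : L2 N) : linear (fun b : L2 M => optensor a b).
Proof.
move=> k x y; apply: val_inj; rewrite /= !optensor_val /=.
by apply/matrixP => i j; rewrite !mxE mulrDr mulrCA.
Qed.

Lemma optensorZl k (a : L2 N) (b : L2 M) : optensor (k *: a) b = k *: optensor a b.
Proof.
apply: val_inj; rewrite /= !optensor_val /=.
by apply/matrixP => i j; rewrite !mxE mulrA.
Qed.
Lemma optensorZr k (a : L2 N) (b : L2 M) : optensor a (k *: b) = k *: optensor a b.
Proof.
apply: val_inj; rewrite /= !optensor_val /=.
by apply/matrixP => i j; rewrite !mxE mulrCA.
Qed.

Lemma Psi'E (x : L2 N) (y : L2 M) :
  Psi' (ketbra x y) = optensor x (vstar (modaut ('i%C / 2) y)).
Proof.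
move: x y; rewrite /Psi'; set P := (X in xget 0 X).
apply: (@xgetPex _ 0 P); rewrite /P /=.
have [f [_ [_ sf]]] := onb M.
pose z : R[i] := 'i%C / 2.
pose F (A : 'Hom(L2 M, L2 N)) := \sum_(g <- f) optensor (A g) (vstar (modaut z g)).
exists (linfun F) => x y; rewrite linfunE => [|k A B]; last first.
  rewrite /F scaler_sumr -big_split; apply: eq_bigr => g _ /=.
  by rewrite add_lfunE scale_lfunE optensor_linearl.
pose K (u : L2 M) := optensor x (vstar (modaut z u)).
have KD u v : K (u + v) = K u + K v.
  rewrite /K /modaut linearD vmulDl vstarD.
  by rewrite -[vstar _ in LHS]scale1r optensor_linearr scale1r.
have KZ k u : K (k *: u) = k^* *: K u.
  by rewrite /K /modaut linearZ vmulZl vstarZ optensorZr.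
have K0 : K 0 = 0 by rewrite -[0 in LHS](scale0r 0) KZ rmorph0 scale0r.
rewrite /F -/(K y) [in RHS](sf y) (big_morph K KD K0).
apply: eq_bigr => g _; rewrite KZ ip_conj ketbraE.
exact: optensorZl.
Qed.

(* On [vsval X] with [X] in [optens N M], this is the action of [X]; it witnesses
   the existence of [optens_act]. *)
Definition optens_actf (X : 'M[R[i]]_(vn_dim N * vn_dim M))
    (T : 'Hom(L2 M, L2 N)) (y : L2 M) : L2 N :=
  vsproj N (\matrix_(i, p) \sum_j \sum_k \sum_l
    X (mxtens_index (i, k)) (mxtens_index (j, l)) *
     vsval (T (vsproj M (delta_mx l k *m vsval y))) j p).

Lemma optens_actE (a : L2 N) (b : L2 M) (T : 'Hom(L2 M, L2 N)) :
  optens_act (optensor a b) T = (lmul a \o T \o lmul b)%VF.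
Proof.
move: a b T; rewrite /optens_act; set P := (X in xget 0 X).
apply: (@xgetPex _ 0 P); rewrite /P /=.
have l1 X T : linear (optens_actf X T).
  move=> c u v; rewrite /optens_actf -linearP; congr vsproj; apply/matrixP => i p.
  rewrite !mxE mulr_sumr -big_split; apply: eq_bigr => j _ /=.
  rewrite mulr_sumr -big_split; apply: eq_bigr => k _ /=.
  rewrite mulr_sumr -big_split; apply: eq_bigr => l _ /=.
  by rewrite mulmxDr -scalemxAr !linearP /= !mxE mulrDr mulrCA.
have l2 X : linear (fun T => linfun (optens_actf X T)).
  move=> c S T; apply/lfunP => y; rewrite add_lfunE scale_lfunE !linfunE // /optens_actf -linearP; congr vsproj.
  apply/matrixP => i p.
  rewrite !mxE mulr_sumr -big_split; apply: eq_bigr => j _ /=.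
  rewrite mulr_sumr -big_split; apply: eq_bigr => k _ /=.
  rewrite mulr_sumr -big_split; apply: eq_bigr => l _ /=.
  by rewrite add_lfunE scale_lfunE /= !mxE mulrDr mulrCA.
pose F (X : subvs_of (optens N M)) := linfun (fun T => linfun (optens_actf (vsval X) T)).
have l3 : linear F.
  move=> c X Y; apply/lfunP => T; rewrite /F add_lfunE scale_lfunE !linfunE //.
  apply/lfunP => y; rewrite add_lfunE scale_lfunE !linfunE // /optens_actf -linearP; congr vsproj.
  apply/matrixP => i p.
  rewrite !mxE mulr_sumr -big_split; apply: eq_bigr => j _ /=.
  rewrite mulr_sumr -big_split; apply: eq_bigr => k _ /=.
  rewrite mulr_sumr -big_split; apply: eq_bigr => l _ /=.
  by rewrite !mxE mulrDl mulrA.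
exists (linfun F) => a b T; rewrite linfunE // /F linfunE //.
apply/lfunP => y; rewrite linfunE // !lfunE /= lfunE /= !lmulE.
apply: val_inj; rewrite /= val_vmul /optens_actf optensor_val.
set W := \matrix_(i, p) _.
suff -> : W = vsval a *m vsval (T (vmul b y)) by rewrite vsprojK // -val_vmul subvsP.
apply/matrixP => i p; rewrite /W !mxE; apply: eq_bigr => j _.
have -> : vmul b y = vsproj M (\sum_l \sum_k (vsval b l k *: delta_mx l k) *m vsval y).
  rewrite /vmul {1}[vsval b]matrix_sum_delta mulmx_suml; congr vsproj.
  by apply: eq_bigr => l _; rewrite mulmx_suml.
rewrite !linear_sum summxE mulr_sumr exchange_big; apply: eq_bigr => l _.
rewrite !linear_sum summxE mulr_sumr; apply: eq_bigr => k _.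
by rewrite -scalemxAl !linearZ /= !mxE !mxtens_indexK /= mulrA.
Qed.
End QuantumRelationTheory.

Lemma qrel_compP (R : realType) (M1 M2 M3 : wvnAlg R)
    (V2 : {vspace 'Hom(L2 M2, L2 M3)}) (V1 : {vspace 'Hom(L2 M1, L2 M2)}) w :
  w \in qrel_comp V2 V1 <->
  exists s : seq ('Hom(L2 M2, L2 M3) * 'Hom(L2 M1, L2 M2)),
    all (fun p => (p.1 \in V2) && (p.2 \in V1)) s /\
    w = \sum_(p <- s) (p.1 \o p.2)%VF.
Proof.
split=> [|[s [/allP sV ->]]].
  move=> /(@coord_span _ _ _ (in_tuple _)) ->; set X := [seq _ | _ <- _, _ <- _].
  have H (i : 'I_(size X)) : exists p : 'Hom(L2 M2, L2 M3) * 'Hom(L2 M1, L2 M2),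
      [/\ p.1 \in V2, p.2 \in V1 & (p.1 \o p.2)%VF = X`_i].
    have /allpairsP[p [p1 p2 ->]] : X`_i \in X by rewrite mem_nth.
    by exists p; rewrite !vbasis_mem.
  have [f Hf] := fin_all_exists H.
  exists [seq (coord (in_tuple X) i w *: (f i).1, (f i).2) | i <- enum 'I_(size X)].
  split; last first.
    rewrite big_map big_enum /=; apply: eq_bigr => i _.
    by rewrite -comp_lfunZl; case: (Hf i) => _ _ ->.
  by apply/allP => _ /mapP[i _ ->] /=; case: (Hf i) => ? ? _; rewrite memvZ.
rewrite big_seq; apply: memv_suml => p /sV /andP[p1 p2].
have H1 v1 v2 : v1 \in vbasis V1 -> v2 \in V2 -> (v2 \o v1)%VF \in qrel_comp V2 V1.
  move=> v1V /coord_vbasis ->; rewrite (big_morph (fun x => x \o v1)%VF (id1 := 0) (op1 := +%R)).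
  - apply: memv_suml => i _; rewrite -comp_lfunZl memvZ // memv_span //.
    by apply: allpairs_f => //; rewrite mem_nth // size_tuple.
  - by move=> a b; rewrite comp_lfunDl.
  - by rewrite comp_lfun0l.
rewrite (coord_vbasis p2) (big_morph (fun x => p.1 \o x)%VF (id1 := 0) (op1 := +%R)).
- apply: memv_suml => i _; rewrite -comp_lfunZr memvZ // H1 //.
  by rewrite mem_nth // size_tuple.
- by move=> a b; rewrite comp_lfunDr.
- by rewrite comp_lfun0r.
Qed.

(* Main.v *)
Require Import Defs.
From HB Require Import structures.
From mathcomp Require Import all_boot all_order all_algebra.
From mathcomp Require Import spectral complex mxtens.
From mathcomp Require Import boolp classical_sets reals sequences exp trigo.
Set Implicit Arguments.
Unset Strict Implicit.
Unset Printing Implicit Defensive.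
Import Order.TTheory GRing.Theory Num.Theory.
Local Open Scope ring_scope.
Local Open Scope sesquilinear_scope.

(** Write h = Q^{1/2} and sigma = nabla^{-1/2}, so that sigma(y) = h^{-1} y h.
The argument rests on one formula for the action of Psi'(A) on rank one
operators, which does not mention any basis ([act_ketbra]):
   Psi'(A) |x><y|  sends z to  A[sigma(z) sigma(y)^* ] x.

If A is completely positive, then A(x y^* ) is the sum of D(x) D(y)^* over
finitely many linear maps D ([cp_gram_factors]): the block matrix of the
A(e_i e_j^* ) is positive, hence of the form C C^* with blocks of C in the
algebra.  With the formula above, Psi'(A) acts on B(L2 M, L2 N) as the sum of
the |v><v| for the Hilbert-Schmidt inner product, where v runs over the maps
z |-> D(sigma(z)) e with e in an orthonormal basis.  Such a sum is injective on
the span of the v, so its image is this span ([limg_rank_one_sum],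
[limg_act]).

In the composition of the two quantum relations, the inner factors
nabla^{1/4} nabla^{1/4} = nabla^{1/2} cancel the sigma that occurs in the
vectors of A2.  Hence V2 V1 is spanned, up to the outer nabla^{1/4}, by the maps
z |-> E(D(sigma(z)) e) e', where D and E run over the factors of A1 and A2.
These are the vectors of A2 A1 for a suitable choice of its factors: as the
(g h) (g h)^* add up to 1 when g runs over an orthonormal basis
([onb_resolution]), the maps D( ) g h factor A1 as well, so the E(D( ) g h)
factor A2 A1, and the elements g h span the algebra ([limg_act_comp]).

For the positivity of Psi'(A), its matrix entries are, up to a permutation of
the indices, those of the blocks A(E_st), where the block matrix E does not
depend on A ([Psi'_psd]).  So it suffices that E is positive.  In the GNS
representation its quadratic form is a sum of squares ([choi_block_form]), and
positivity there implies positivity of the matrix because the spectral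
projections of E have their blocks in the algebra ([psdmx_block_ip]). *)

(** * Functional calculus of normal matrices *)

HB.lock Definition specmx (C : numClosedFieldType) n (A : 'M[C]_n) (d : 'rV[C]_n) : 'M[C]_n :=
  (spectralmx A)^t* *m diag_mx d *m spectralmx A.

HB.lock Definition fcalc (C : numClosedFieldType) n (A : 'M[C]_n) (f : C -> C) : 'M[C]_n :=
  specmx A (map_mx f (spectral_diag A)).

Section FunctionalCalculus.
Variables (C : numClosedFieldType) (n : nat).
Implicit Types (A : 'M[C]_n) (d e : 'rV[C]_n) (f g : C -> C).

Lemma adjmxM m p q (A : 'M[C]_(m, p)) (B : 'M[C]_(p, q)) :
  (A *m B)^t* = B^t* *m A^t*.
Proof. by rewrite trmx_mul map_mxM. Qed.

Lemma skewadj_normalmx A : A^t* = - A -> A \is normalmx.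
Proof. by move=> AN; apply/normalmxP; rewrite AN mulmxN mulNmx. Qed.

Lemma selfadj_normalmx A : A^t* = A -> A \is normalmx.
Proof. by move=> AN; apply/normalmxP; rewrite AN. Qed.

Let P A := spectralmx A.
Let PPh A : P A *m (P A)^t* = 1%:M.
Proof. exact/unitarymxP/spectral_unitarymx. Qed.
Let PhP A : (P A)^t* *m P A = 1%:M.
Proof. exact: mulmx1C (PPh A). Qed.

Lemma specmx_id A : A \is normalmx -> specmx A (spectral_diag A) = A.
Proof.
move=> /orthomx_spectralP nA; rewrite [RHS]nA specmx.unlock invmx_unitary //.
exact: spectral_unitarymx.
Qed.

Lemma specmx1 A : specmx A (const_mx 1) = 1%:M.
Proof. by rewrite !specmx.unlock diag_const_mx mulmx1 PhP. Qed.

Lemma specmxM A d e : specmx A d *m specmx A e = specmx A (\row_i (d 0 i * e 0 i)).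
Proof.
rewrite !specmx.unlock -!mulmxA (mulmxA (spectralmx A)) (PPh A) mul1mx.
rewrite [diag_mx d *m _]mulmxA mulmx_diag; congr (_ *m (diag_mx _ *m _)).
Qed.

Lemma specmx_linear A k d e : specmx A (k *: d + e) = k *: specmx A d + specmx A e.
Proof. by rewrite !specmx.unlock linearP mulmxDr mulmxDl -scalemxAr -scalemxAl. Qed.

Lemma specmx0 A : specmx A 0 = 0.
Proof. by rewrite !specmx.unlock linear0 mulmx0 mul0mx. Qed.

Lemma specmx_adj A d : (specmx A d)^t* = specmx A (map_mx Num.conj d).
Proof.
rewrite !specmx.unlock !adjmxM trmxCK mulmxA; congr (_ *m _ *m _).
by apply/matrixP => i j; rewrite !mxE eq_sym; case: eqP => [->|_]; rewrite ?mulr1n ?mulr0n ?rmorph0.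
Qed.

Lemma specmx_inj A : injective (specmx A).
Proof.
move=> d e de.
have {de} : P A *m specmx A d *m (P A)^t* = P A *m specmx A e *m (P A)^t* by rewrite de.
rewrite !specmx.unlock !mulmxA (PPh A) !mul1mx -!mulmxA (PPh A) !mulmx1 => /matrixP de.
by apply/rowP => i; have := de i i; rewrite !mxE eqxx.
Qed.

Variable S : 'M[C]_n -> Prop.
Hypothesis S1 : S 1%:M.
Hypothesis SM : forall A B, S A -> S B -> S (A *m B).
Hypothesis SP : forall k A B, S A -> S B -> S (k *: A + B).

(** Lagrange interpolation on the spectrum: f(A) is a polynomial in A, so it
stays in every unital algebra that contains A. *)
Lemma fcalc_closed A f : A \is normalmx -> S A -> S (fcalc A f).
Proof.
move=> nA SA; set D := spectral_diag A.
have S0 : S 0 by rewrite -[0](subrr 1%:M) addrC -scaleN1r; exact: SP.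
have Saff (l k : C) : S (specmx A (\row_i (k * (D 0 i - l)))).
  have -> : \row_i (k * (D 0 i - l)) = k *: (D + (- l) *: const_mx 1) + 0.
    by apply/rowP => i; rewrite !mxE mulr1 addr0.
  rewrite specmx_linear; apply: SP; last first.
    by rewrite specmx0.
  by rewrite addrC specmx_linear specmx_id // specmx1; exact: SP.
(* The Lagrange polynomial of [l] relative to the nodes [r], evaluated at the
   eigenvalues. *)
pose delta (r : seq C) (l : C) : 'rV[C]_n :=
  \row_i \prod_(m <- r | m != l) ((l - m)^-1 * (D 0 i - m)).
have Sdelta r l : S (specmx A (delta r l)).
  elim: r => [|m r IH]; rewrite /delta.
    rewrite (_ : \row_i _ = const_mx 1) ?specmx1 //.
    by apply/rowP => i; rewrite !mxE big_nil.
  case ml : (m != l); last first.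
    rewrite (_ : \row_i _ = delta r l) //.
    by apply/rowP => i; rewrite !mxE big_cons ml.
  have := SM (Saff m (l - m)^-1) IH; rewrite specmxM; congr (S (specmx _ _)).
  by apply/rowP => i; rewrite !mxE big_cons ml.
pose r := undup [seq D 0 i | i : 'I_n].
have rD i : D 0 i \in r by rewrite mem_undup; apply: map_f; rewrite mem_enum.
have deltaE l i : l \in r -> delta r l 0 i = (D 0 i == l)%:R.
  move=> lr; rewrite mxE; case: eqP => [->|/eqP Dl].
    rewrite big1_seq // => m /andP[ml _].
    by rewrite mulVf // subr_eq0 eq_sym.
  apply/eqP; rewrite prodf_seq_eq0; apply/hasP; exists (D 0 i) => //.
  by rewrite Dl subrr mulr0 eqxx.
have -> : fcalc A f = \sum_(l <- r) f l *: specmx A (delta r l).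
  rewrite fcalc.unlock -/D.
  have lin : {morph specmx A : d e / d + e}.
    by move=> d e; rewrite -[d]scale1r specmx_linear !scale1r.
  under eq_bigr => l _.
    rewrite -[_ *: _]addr0 -[in X in _ + X](specmx0 A) -specmx_linear addr0. over.
  rewrite -(big_morph _ lin (specmx0 A)); congr (specmx _ _).
  apply/rowP => i; rewrite summxE mxE (bigD1_seq (D 0 i)) ?undup_uniq //=.
  rewrite big1_seq => [|l /andP[lD lr]].
    by rewrite addr0 mxE deltaE // eqxx mulr1.
  by rewrite mxE deltaE // eq_sym (negbTE lD) mulr0.
move: (delta r) (Sdelta r) {rD deltaE} => dr Sdr.
by elim: r => [|l r IH]; rewrite (big_nil, big_cons) //; apply: SP.
Qed.

End FunctionalCalculus.

Section SpectralPositivity.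
Variables (C : numClosedFieldType) (n : nat).
Implicit Types (A : 'M[C]_n) (f g : C -> C).

Lemma fcalcM A f g : fcalc A f *m fcalc A g = fcalc A (fun x => f x * g x).
Proof.
by rewrite !fcalc.unlock specmxM; congr specmx; apply/rowP => i; rewrite !mxE.
Qed.

Lemma eq_fcalc A f g : (forall i, f (spectral_diag A 0 i) = g (spectral_diag A 0 i)) ->
  fcalc A f = fcalc A g.
Proof. by move=> fg; rewrite !fcalc.unlock; congr specmx; apply/rowP => i; rewrite !mxE. Qed.

Lemma fcalcZ A k f : k *: fcalc A f = fcalc A (fun x => k * f x).
Proof.
rewrite -[LHS]addr0 -[X in _ + X](specmx0 A) !fcalc.unlock -specmx_linear; congr specmx.
by apply/rowP => i; rewrite !mxE addr0.
Qed.

Lemma fcalc_id A : A \is normalmx -> fcalc A id = A.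
Proof.
move=> nA; rewrite !fcalc.unlock -[RHS]specmx_id //; congr specmx.
by apply/rowP => i; rewrite !mxE.
Qed.

Lemma fcalc1 A : fcalc A (fun=> 1) = 1%:M.
Proof. by rewrite fcalc.unlock -(specmx1 A); congr specmx; apply/rowP => i; rewrite !mxE. Qed.

Lemma fcalc_adj A f : (fcalc A f)^t* = fcalc A (fun x => (f x)^*).
Proof. by rewrite !fcalc.unlock specmx_adj; congr specmx; apply/rowP => i; rewrite !mxE. Qed.

Definition specproj A i := fcalc A (fun x => (x == spectral_diag A 0 i)%:R).

Lemma specproj_neq0 A i : specproj A i != 0.
Proof.
apply/eqP; rewrite /specproj fcalc.unlock -(specmx0 A) => /specmx_inj /rowP /(_ i).
by rewrite !mxE eqxx => /eqP; rewrite oner_eq0.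
Qed.

Lemma specproj_adj A i : (specproj A i)^t* = specproj A i.
Proof. by rewrite fcalc_adj; apply: eq_fcalc => j; rewrite rmorph_nat. Qed.

Lemma specproj_idem A i : specproj A i *m specproj A i = specproj A i.
Proof. by rewrite fcalcM; apply: eq_fcalc => j; rewrite -natrM mulnb andbb. Qed.

Lemma specproj_eigen A i : A \is normalmx ->
  A *m specproj A i = spectral_diag A 0 i *: specproj A i.
Proof.
move=> nA; rewrite -[A in A *m _]fcalc_id // fcalcM fcalcZ; apply: eq_fcalc => j.
by case: eqP => [->|_]; rewrite ?mulr1 ?mulr0.
Qed.

(** In the eigenbases of A and B, the map x |-> f(A) x g(B) multiplies the entry
(i, j) by f(a_i) g(b_j); so an eigenvector has nonzero entries only where this
number is the eigenvalue. *)
Lemma fcalc_sandwich A B (x : 'M[C]_n) f g f' g' (k l : C) :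
  (forall i j, f (spectral_diag A 0 i) * g (spectral_diag B 0 j) = l ->
     f' (spectral_diag A 0 i) * g' (spectral_diag B 0 j) = k) ->
  fcalc A f *m x *m fcalc B g = l *: x -> fcalc A f' *m x *m fcalc B g' = k *: x.
Proof.
have PP D : spectralmx D *m (spectralmx D)^t* = 1%:M :> 'M[C]_n.
  exact/unitarymxP/spectral_unitarymx.
have PhP D : (spectralmx D)^t* *m spectralmx D = 1%:M :> 'M[C]_n.
  exact: mulmx1C (PP D).
pose y := spectralmx A *m x *m (spectralmx B)^t*.
have sy h h' i j : (spectralmx A *m (fcalc A h *m x *m fcalc B h') *m (spectralmx B)^t*) i j =
    (h (spectral_diag A 0 i) * h' (spectral_diag B 0 j)) * y i j.
  rewrite (_ : _ *m _ = diag_mx (map_mx h (spectral_diag A)) *m y *m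
      diag_mx (map_mx h' (spectral_diag B))).
    by rewrite mul_diag_mx mul_mx_diag !mxE mulrAC.
  by rewrite !fcalc.unlock !specmx.unlock /y !mulmxA PP mul1mx -!mulmxA PP mulmx1.
move=> fgl; move/(congr1 (fun z => spectralmx A *m z *m (spectralmx B)^t*)) => e.
suff : spectralmx A *m (fcalc A f' *m x *m fcalc B g') *m (spectralmx B)^t* =
    spectralmx A *m (k *: x) *m (spectralmx B)^t*.
  move/(congr1 (fun z => (spectralmx A)^t* *m z *m (spectralmx B))).
  by rewrite !mulmxA PhP !mul1mx -!mulmxA PhP !mulmx1.
apply/matrixP => i j; rewrite sy.
move/matrixP/(_ i j): e; rewrite sy -!(scalemxAl, scalemxAr) !mxE.
rewrite -/(y i j) => /eqP; rewrite -subr_eq0 -mulrBl mulf_eq0 subr_eq0.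
by case/orP=> [/eqP/fgl ->|/eqP ->] //; rewrite !mulr0.
Qed.

End SpectralPositivity.

(** * Positive semidefinite matrices *)

Section PositiveMatrices.
Variable (R : realType).
Local Notation C := R[i].

Lemma adjmx_mul_diagE n p (v : 'M[C]_(n, p)) j : (v^t* *m v) j j = \sum_i `|v i j| ^+ 2.
Proof. by rewrite mxE; apply: eq_bigr => i _; rewrite !mxE normCKC. Qed.

Lemma adjmx_mul_ge0 n (v : 'cV[C]_n) : 0 <= (v^t* *m v) 0 0.
Proof. by rewrite adjmx_mul_diagE; apply: sumr_ge0 => i _; rewrite exprn_ge0. Qed.

Lemma adjmx_mul_eq0 n (v : 'cV[C]_n) : (v^t* *m v) 0 0 = 0 -> v = 0.
Proof.
rewrite adjmx_mul_diagE => /eqP; rewrite psumr_eq0 => [/allP v0|i _]; last exact: exprn_ge0.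
apply/colP => i; apply/eqP; rewrite mxE -normr_eq0 -sqrf_eq0.
by apply: (v0 i); rewrite mem_index_enum.
Qed.

Lemma spectral_vector n (A : 'M[C]_n) i : A \is normalmx ->
  exists v : 'cV[C]_n, 0 < (v^t* *m v) 0 0 /\
    (v^t* *m A *m v) 0 0 = spectral_diag A 0 i * (v^t* *m v) 0 0.
Proof.
move=> nA; have [j vj] : exists j, col j (specproj A i) != 0.
  apply/existsP; rewrite -negb_forall; apply: contra (specproj_neq0 A i) => /forallP E0.
  apply/eqP/matrixP => r c; have /eqP/colP/(_ r) := E0 c.
  by rewrite !mxE.
exists (col j (specproj A i)); split.
  rewrite lt_neqAle adjmx_mul_ge0 andbT eq_sym.
  by apply: contra vj => /eqP/adjmx_mul_eq0 ->.
by rewrite -mulmxA !colE [A *m _]mulmxA specproj_eigen // -scalemxAl -scalemxAr mxE.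
Qed.

(** The quadratic form of K = A - A^* vanishes, hence so do the eigenvalues of
the normal matrix K. *)
Lemma psdmx_herm n (A : 'M[C]_n) : psdmx A -> A^t* = A.
Proof.
move=> psdA; pose K := A - A^t*.
have Kv (v : 'cV_n) : (v^t* *m K *m v) 0 0 = 0.
  rewrite mulmxBr mulmxBl mxE [X in _ + X]mxE.
  have -> : v^t* *m A^t* *m v = (v^t* *m A *m v)^t*.
    by rewrite !adjmxM trmxCK mulmxA.
  by rewrite !mxE (CrealP _) ?subrr // ger0_real //; have := psdA v; rewrite mxE.
have KN : K^t* = - K.
  by rewrite /K linearB /= map_mxB trmxCK opprB.
have nK := skewadj_normalmx KN.
suff K0 : spectral_diag K = 0.
  by apply/eqP; rewrite eq_sym -subr_eq0 -/K -(specmx_id nK) K0 specmx0.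
apply/rowP => i; rewrite [RHS]mxE.
have [v [v_gt0 vE]] := spectral_vector i nK.
by have /eqP := Kv v; rewrite vE mulf_eq0 [X in _ || X]gt_eqF // orbF => /eqP.
Qed.

Lemma psdmx_spectral_ge0 n (A : 'M[C]_n) i : psdmx A -> 0 <= spectral_diag A 0 i.
Proof.
move=> psdA; have [v [v_gt0 vE]] := spectral_vector i (selfadj_normalmx (psdmx_herm psdA)).
by have := psdA v; rewrite vE pmulr_lge0.
Qed.

Lemma psdmx_mul_adj n p (B : 'M[C]_(n, p)) : psdmx (B *m B^t*).
Proof.
move=> v; rewrite mulmxA -mulmxA.
have -> : v^t* *m B = (B^t* *m v)^t* by rewrite adjmxM trmxCK.
exact: adjmx_mul_ge0.
Qed.

Lemma fcalc_sqrt n (A : 'M[C]_n) : A \is normalmx ->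
  (forall i, 0 <= spectral_diag A 0 i) -> A = fcalc A sqrtC *m (fcalc A sqrtC)^t*.
Proof.
move=> nA A_ge0; rewrite fcalc_adj fcalcM -[LHS](fcalc_id nA); apply: eq_fcalc => i.
by rewrite (CrealP _) ?ger0_real ?sqrtC_ge0 // -expr2 sqrtCK.
Qed.

Lemma psdmx_spectral n (A : 'M[C]_n) : A \is normalmx ->
  (forall i, 0 <= spectral_diag A 0 i) -> psdmx A.
Proof. by move=> nA A_ge0; rewrite (fcalc_sqrt nA A_ge0); exact: psdmx_mul_adj. Qed.

Lemma psdmx_congruence n p (A : 'M[C]_n) (B : 'M[C]_(p, n)) :
  psdmx A -> psdmx (B *m A *m B^t*).
Proof.
move=> psdA v; have := psdA (B^t* *m v).
by rewrite adjmxM trmxCK !mulmxA.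
Qed.

Lemma psdmx_mxsub n p (A : 'M[C]_n) (f : 'I_p -> 'I_n) :
  psdmx A -> psdmx (mxsub f f A).
Proof.
move=> /(@psdmx_congruence _ _ _ (rowsub f 1%:M)).
have -> : (rowsub f 1%:M)^t* = colsub f (1%:M : 'M[C]_n).
  by apply/matrixP => i j; rewrite !mxE rmorph_nat eq_sym.
rewrite mul_rowsub_mx mul1mx mulmx_colsub mulmx1.
by rewrite (_ : colsub f _ = mxsub f f A) //; apply/matrixP => i j; rewrite !mxE.
Qed.

End PositiveMatrices.

(** * Block matrices over an algebra *)

Section BlockMatrices.
Variables (R : realType) (M : vnAlg R) (d : nat).
Implicit Types X Y : 'M[vn_elt M]_d.

Definition blockmx X := \mxblock_(i < d, j < d) vsval (X i j).

Lemma blockmx1 : blockmx (\matrix_(i, j) if i == j then vone M else 0) = 1%:M.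
Proof.
rewrite -mxdiagZ; apply: eq_mxblock => i j; rewrite mxE.
have [ij|_] := eqVneq i j; last by rewrite linear0.
by subst j; rewrite conform_mx_id val_vone.
Qed.

Lemma blockmxM X Y :
  blockmx X *m blockmx Y = blockmx (\matrix_(i, j) \sum_k vmul (X i k) (Y k j)).
Proof.
rewrite mul_mxblock; apply: eq_mxblock => i j; rewrite mxE linear_sum.
by apply: eq_bigr => k _ /=; rewrite val_vmul.
Qed.

Lemma blockmx_linear k X Y : 
  k *: blockmx X + blockmx Y = blockmx (\matrix_(i, j) (k *: X i j + Y i j)).
Proof. by apply/matrixP => r c; rewrite !mxE. Qed.

Lemma blockmx_adj X : (blockmx X)^t* = blockmx (\matrix_(i, j) vstar (X j i)).
Proof. by apply/matrixP => r c; rewrite !mxE val_vstar !mxE. Qed.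

Lemma blockmx_inj : injective blockmx.
Proof.
move=> X Y XY; apply/matrixP => i j; apply: val_inj.
by have := congr1 (fun B => submxblock B i j) XY; rewrite /blockmx !mxblockK.
Qed.

Lemma blockmx_fcalc X f : blockmx X \is normalmx ->
  exists Y, fcalc (blockmx X) f = blockmx Y.
Proof.
move=> nX; apply: (fcalc_closed (S := fun B => exists Y, B = blockmx Y)) => //.
- by exists (\matrix_(i, j) if i == j then vone M else 0); rewrite blockmx1.
- by move=> _ _ [Y ->] [Z ->]; rewrite blockmxM; eexists.
- by move=> k _ _ [Y ->] [Z ->]; rewrite blockmx_linear; eexists.
- by exists X.
Qed.

(** The square root of a positive element of M_d(M) is again in M_d(M). *)
Lemma psdmx_block_factor X : psdmx (blockmx X) ->
  exists Y, forall i j, X i j = \sum_k vmul (Y i k) (vstar (Y j k)).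
Proof.
move=> psdX; have nX := selfadj_normalmx (psdmx_herm psdX).
have [Y YE] := blockmx_fcalc sqrtC nX; exists Y => i j.
have /blockmx_inj -> : blockmx X = blockmx (\matrix_(i, j) \sum_k vmul (Y i k) (vstar (Y j k))).
  rewrite [LHS]fcalc_sqrt // => [|k]; last exact: psdmx_spectral_ge0.
  rewrite YE blockmx_adj blockmxM; congr blockmx; apply/matrixP => r c.
  by rewrite !mxE; apply: eq_bigr => k _; rewrite mxE.
by rewrite mxE.
Qed.

Lemma psdmx_block_gram (x : 'I_d -> vn_elt M) :
  psdmx (blockmx (\matrix_(i, j) vmul (x i) (vstar (x j)))).
Proof.
pose H := \mxcol_(i < d) vsval (x i).
rewrite (_ : blockmx _ = H *m H^t*); first exact: psdmx_mul_adj.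
have -> : H^t* = \mxrow_(j < d) (vsval (x j))^t*.
  by apply/matrixP => r c; rewrite !mxE.
rewrite mul_mxcol_mxrow; apply: eq_mxblock => i j.
by rewrite mxE val_vmul val_vstar.
Qed.

End BlockMatrices.

(** * Factorization of completely positive maps *)

Definition parseval (R : realType) (M : wvnAlg R) (f : seq (L2 M)) : Prop :=
  forall v, v = \sum_(g <- f) ip g v *: g.

Section Sums.
Variables (R : realType) (M : wvnAlg R) (I : Type) (r : seq I) (F : I -> L2 M).

Lemma vmul_suml z : vmul (\sum_(i <- r) F i) z = \sum_(i <- r) vmul (F i) z.
Proof.
apply: (big_morph (fun x => vmul x z)) => [x y|]; first exact: vmulDl.
by rewrite -[in LHS](scale0r 0) vmulZl scale0r.
Qed.

Lemma vmul_sumr z : vmul z (\sum_(i <- r) F i) = \sum_(i <- r) vmul z (F i).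
Proof. exact: linear_sum. Qed.

Lemma vmulZr k x y : vmul x (k *: y) = k *: vmul x y :> L2 M.
Proof. exact: (linearZ_LR (vmul x)). Qed.

Lemma vstar_sum : vstar (\sum_(i <- r) F i) = \sum_(i <- r) vstar (F i).
Proof.
apply: (big_morph (@vstar R M)) => [x y|]; first exact: vstarD.
by rewrite -[in LHS](scale0r 0) vstarZ rmorph0 scale0r.
Qed.

Lemma ip_suml z : ip (\sum_(i <- r) F i) z = \sum_(i <- r) ip (F i) z.
Proof. by rewrite -ip_conj ip_sumr rmorph_sum; apply: eq_bigr => i _; exact: ip_conj. Qed.

End Sums.

(** A Kolmogorov decomposition of the kernel (x, y) |-> A(x y^* ). *)
Definition gram_factors (R : realType) (M N : wvnAlg R) (A : 'Hom(L2 M, L2 N))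
    (s : seq 'Hom(L2 M, L2 N)) : Prop :=
  forall x y, A (vmul x (vstar y)) = \sum_(D <- s) vmul (D x) (vstar (D y)).

(** For a basis e of M, complete positivity makes the block matrix of the
A(e_i e_j^* ) positive; its factor C then gives the maps D_u with
D_u(e_i) = C_iu. *)
Lemma cp_gram_factors (R : realType) (M N : wvnAlg R) (A : 'Hom(L2 M, L2 N)) :
  completely_positive A -> exists s, gram_factors A s.
Proof.
move=> cpA; pose e := vbasis {:L2 M}; pose d := \dim {:L2 M}.
pose X : 'M[L2 M]_d := \matrix_(i, j) vmul e`_i (vstar e`_j).
have psdAX : psdmx (blockmx (\matrix_(i, j) A (X i j))).
  have := cpA _ _ (psdmx_block_gram (fun i : 'I_d => e`_i)).
  rewrite (_ : mxblock _ = blockmx (\matrix_(i, j) A (X i j))) //.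
  by apply: eq_mxblock => i j; rewrite !mxE.
have [C CE] := psdmx_block_factor psdAX.
pose D u y : L2 N := \sum_i coord e i y *: C i u.
have linD u : linear (D u).
  move=> k x y; rewrite /D scaler_sumr -big_split; apply: eq_bigr => i _ /=.
  by rewrite linearP scalerDl scalerA.
exists [seq linfun (D u) | u : 'I_d] => x y.
rewrite big_map big_enum /=.
under eq_bigr => u _ do rewrite !(linfunE (linD u)).
have AXE (i j : 'I_d) : A (vmul e`_i (vstar e`_j)) = \sum_u vmul (C i u) (vstar (C j u)).
  by rewrite -CE !mxE.
rewrite {1}(coord_vbasis (memvf x)) {1}(coord_vbasis (memvf y)) vstar_sum vmul_suml.
rewrite linear_sum /= /D; under [RHS]eq_bigr => u _ do rewrite vstar_sum vmul_suml.
rewrite [RHS]exchange_big; apply: eq_bigr => i _ /=.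
rewrite vmul_sumr linear_sum /=; under [RHS]eq_bigr => u _ do rewrite vmul_sumr.
rewrite [RHS]exchange_big; apply: eq_bigr => j _ /=.
rewrite vstarZ vmulZl linearZ linearZ linearZ /= AXE !scaler_sumr.
by apply: eq_big => // u _; rewrite vstarZ vmulZl vmulZr.
Qed.

(** * The Markov trace and the density *)

HB.lock Definition dens_calc (R : realType) (M : wvnAlg R) (f : R[i] -> R[i]) : L2 M :=
  vsproj M (fcalc (vsval (density M)) f).

Section Density.
Variables (R : realType) (M : wvnAlg R).
Implicit Types x y z : L2 M.
Local Notation C := R[i].
Local Notation Tr := (@markov_trace R M).
Local Notation Q := (density M).
Local Notation dens_calc := (@dens_calc R M).

Lemma v1mul x : vmul (vone M) x = x.
Proof. by apply: val_inj; rewrite /= val_vmul val_vone mul1mx. Qed.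

Lemma vstar1 : vstar (vone M) = vone M.
Proof.
apply: val_inj; rewrite /= val_vstar val_vone.
by apply/matrixP => i j; rewrite !mxE rmorph_nat eq_sym.
Qed.

Lemma vstar_inj : injective (@vstar R M).
Proof. exact: can_inj (@vstarK R M). Qed.

Lemma markov_traceC x y : Tr (vmul x y) = Tr (vmul y x).
Proof.
have [f [_ [_ sf]]] := onb M.
have trE a b : Tr (vmul a b) = \sum_(g <- f) \sum_(h <- f) ip g (vmul a h) * ip h (vmul b g).
  rewrite /markov_trace (optraceE _ sf); apply: eq_bigr => g _.
  rewrite lmulE -vmulA [in LHS](sf (vmul b g)) vmul_sumr ip_sumr.
  by apply: eq_bigr => h _; rewrite linearZ ipZr mulrC.
rewrite (trE x y) (trE y x) exchange_big; apply: eq_bigr => g _; apply: eq_bigr => h _.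
by rewrite mulrC.
Qed.

Lemma markov_trace_star x : Tr (vstar x) = (Tr x)^*.
Proof.
have [f [_ [_ sf]]] := onb M.
rewrite /markov_trace !(optraceE _ sf) rmorph_sum; apply: eq_bigr => g _ /=.
by rewrite ip_conj !lmulE ip_lmul vstarK.
Qed.

Lemma phi_star x : wvn_phi M (vstar x) = (wvn_phi M x)^*.
Proof. by have := ip_conj (vone M) x; rewrite /ip vstar1 v1mul vmul1 => ->. Qed.

Lemma markov_trace_nondeg x : (forall y, Tr (vmul x y) = 0) -> x = 0.
Proof.
move=> x0; apply: vstar_inj; rewrite (_ : vstar 0 = 0); last first.
  by rewrite -[in LHS](scale0r (0 : L2 M)) vstarZ rmorph0 scale0r.
by apply: markov_trace_faithful; rewrite vstarK.
Qed.

Lemma markov_traceB x y : Tr (x - y) = Tr x - Tr y.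
Proof. exact: (linearB (@markov_trace R M : {linear _ -> C^o})). Qed.

Lemma markov_traceZ k x : Tr (k *: x) = k * Tr x.
Proof. exact: (linearZ_LR (@markov_trace R M : {linear _ -> C^o})). Qed.

(** Both Q and Q^* represent the functional through the Markov trace, which is
nondegenerate. *)
Lemma density_herm : vstar Q = Q.
Proof.
apply/eqP; rewrite -subr_eq0; apply/eqP/markov_trace_nondeg => y.
rewrite -scaleN1r vmulDl vmulZl scaleN1r markov_traceB -densityE.
rewrite -[y in vmul _ y]vstarK -vstarM markov_trace_star markov_traceC -densityE.
by rewrite phi_star conjCK subrr.
Qed.

Lemma density_normal : vsval Q \is normalmx.
Proof. by apply: selfadj_normalmx; rewrite -val_vstar density_herm. Qed.

Lemma val_dens_calc f : vsval (dens_calc f) = fcalc (vsval Q) f.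
Proof.
rewrite dens_calc.unlock vsprojK //; apply: (fcalc_closed (S := fun A => A \in vn_car M)).
- exact: vn_one.
- by move=> A B; exact: vn_mul.
- by move=> k A B AM BM; rewrite rpredD ?rpredZ.
- exact: density_normal.
- exact: subvsP.
Qed.

Definition dens_eig i : C := spectral_diag (vsval Q) 0 i.

(** For the spectral projection E of an eigenvalue l, the number l Tr(E) is the
value of the faithful functional at E = E^* E, and Tr(E) is nonnegative. *)
Lemma dens_eig_gt0 i : 0 < dens_eig i.
Proof.
pose E := dens_calc (fun c => (c == dens_eig i)%:R).
have EE : vsval E = specproj (vsval Q) i by rewrite val_dens_calc.
have EsE : vmul (vstar E) E = E.
  by apply: val_inj; rewrite /= val_vmul val_vstar EE specproj_adj specproj_idem.
have E0 : E != 0.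
  by apply: contra (specproj_neq0 (vsval Q) i) => /eqP E0; rewrite -EE E0 linear0.
have QE : vmul Q E = dens_eig i *: E.
  by apply: val_inj; rewrite /= val_vmul EE specproj_eigen //; exact: density_normal.
have phiE : 0 < wvn_phi M E.
  rewrite lt_neqAle -EsE wvn_phi_ge0 andbT eq_sym.
  by apply: contra E0 => /eqP/wvn_phi_faithful ->.
have TrE : 0 <= Tr E.
  rewrite -EsE; have [f [_ [_ sf]]] := onb M.
  rewrite /markov_trace (optraceE _ sf); apply: sumr_ge0 => g _.
  by rewrite lmulE -vmulA ip_lmul vstarK ip_ge0.
move: phiE; rewrite densityE QE markov_traceZ.
move: TrE; rewrite le_eqVlt => /orP[/eqP <-|TrE]; first by rewrite mulr0 ltxx.
by rewrite pmulr_lgt0.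
Qed.

Lemma dens_calcM f g : vmul (dens_calc f) (dens_calc g) = dens_calc (fun c => f c * g c).
Proof. by apply: val_inj; rewrite /= val_vmul !val_dens_calc fcalcM. Qed.

Lemma dens_calcZ k f : k *: dens_calc f = dens_calc (fun c => k * f c).
Proof. by apply: val_inj; rewrite /= !val_dens_calc fcalcZ. Qed.

Lemma eq_dens_calc f g : (forall i, f (dens_eig i) = g (dens_eig i)) ->
  dens_calc f = dens_calc g.
Proof. by move=> fg; rewrite !dens_calc.unlock (eq_fcalc fg). Qed.

Lemma dens_calc_id : dens_calc id = Q.
Proof. by apply: val_inj; rewrite /= val_dens_calc fcalc_id //; exact: density_normal. Qed.

Lemma dens_calc1 : dens_calc (fun=> 1) = vone M.
Proof. by apply: val_inj; rewrite /= val_dens_calc fcalc1 val_vone. Qed.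

Lemma dens_calc_star f : vstar (dens_calc f) = dens_calc (fun c => (f c)^*).
Proof. by apply: val_inj; rewrite /= val_vstar !val_dens_calc fcalc_adj. Qed.

Lemma dens_calcV : vinv Q = dens_calc (fun c => c^-1).
Proof.
rewrite dens_calc.unlock; congr vsproj; have e : vsval Q *m fcalc (vsval Q) (fun c => c^-1) = 1%:M.
  rewrite -[X in X *m _]fcalc_id ?density_normal // fcalcM -(fcalc1 (vsval Q)).
  by apply: eq_fcalc => i; rewrite mulfV // gt_eqF // dens_eig_gt0.
have [uQ _] := mulmx1_unit e.
by rewrite -[LHS]mulmx1 -e mulmxA mulVmx // mul1mx.
Qed.

End Density.

(** * Powers of the density and of the modular operator *)

Section OperatorPowers.
Local Open Scope complex_scope.
Variable (R : realType).
Local Notation C := R[i].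

(** The real power c^r of a positive number c, as a complex number. *)
Definition rpow (r : R) (c : C) : C := (expR (r * ln (complex.Re c)))%:C.

Lemma cpow_real (c : C) (r : R) : cpow c r%:C = rpow r c.
Proof.
rewrite /cpow /expC -rmorphM /=.
by rewrite cos0 sin0 mulr1.
Qed.

Lemma rpowD (r s : R) c : rpow r c * rpow s c = rpow (r + s) c.
Proof. by rewrite /rpow -rmorphM -expRD mulrDl. Qed.

Lemma rpow0 c : rpow 0 c = 1.
Proof. by rewrite /rpow mul0r expR0. Qed.

Lemma rpow_conj r c : Num.conj (rpow r c) = rpow r c.
Proof. by apply/CrealP/ger0_real; rewrite lecR expR_ge0. Qed.

Lemma pos_complexP (c : C) : 0 < c -> exists2 a : R, 0 < a & c = a%:C.
Proof. by case: c => a b; rewrite ltcE /= => /andP[/eqP -> a0]; exists a. Qed.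

Lemma rpow1 c : 0 < c -> rpow 1 c = c.
Proof. by move=> /pos_complexP[a a0 ->]; rewrite /rpow /= mul1r lnK. Qed.

Lemma rpow_div r (c d : C) : 0 < c -> 0 < d -> rpow r (c / d) = rpow r c * rpow (- r) d.
Proof.
move=> /pos_complexP[a a0 ->] /pos_complexP[b b0 ->].
rewrite /rpow -fmorphV -!rmorphM /= ln_div // mulrBr expRD.
by rewrite mulNr.
Qed.

(** [S] has the property that defines [opow T z], and this property determines an
operator when the eigenvectors of [T] span the space. *)
Lemma opow_unique (V : vectType C) (T S : 'End(V)) z (I : Type) (l : I -> C) :
  (forall c v, T v = c *: v -> S v = cpow c z *: v) ->
  (forall v, exists (r : seq I) (F : I -> V),
     v = \sum_(i <- r) F i /\ forall i, T (F i) = l i *: F i) ->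
  opow T z = S.
Proof.
move=> Sz dec; have Tz : forall c v, T v = c *: v -> opow T z v = cpow c z *: v.
  rewrite /opow; set P := (X in xget 0 X).
  by apply: (@xgetPex _ 0 P); exists S.
apply/lfunP => v; have [r [F [-> TF]]] := dec v.
rewrite !linear_sum; apply: eq_bigr => i _ /=.
by rewrite (Tz _ _ (TF i)) (Sz _ _ (TF i)).
Qed.

End OperatorPowers.

Section DensityPowers.
Local Open Scope complex_scope.
Variables (R : realType) (M : wvnAlg R).
Implicit Types x y z : L2 M.
Local Notation C := R[i].
Local Notation Q := (density M).

Definition dpow (r : R) : L2 M := dens_calc M (rpow r).
Definition rmul (a : L2 M) : 'End(L2 M) := linfun (fun y => vmul y a).

Lemma rmulE a x : rmul a x = vmul x a.
Proof. by rewrite (linfunE (F := fun y => vmul y a)) //; exact: vmul_linearl. Qed.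

Lemma dpowD r s : vmul (dpow r) (dpow s) = dpow (r + s).
Proof. by rewrite /dpow dens_calcM; apply: eq_dens_calc => i; rewrite rpowD. Qed.

Lemma dpow0 : dpow 0 = vone M.
Proof. by rewrite -dens_calc1; apply: eq_dens_calc => i; rewrite rpow0. Qed.

Lemma dpow_opp r : vmul (dpow r) (dpow (- r)) = vone M.
Proof. by rewrite dpowD subrr dpow0. Qed.

Lemma dpow1 : dpow 1 = Q.
Proof.
by rewrite -[RHS]dens_calc_id; apply: eq_dens_calc => i; rewrite rpow1 // dens_eig_gt0.
Qed.

Lemma dpow_star r : vstar (dpow r) = dpow r.
Proof. by rewrite dens_calc_star; apply: eq_dens_calc => i; rewrite rpow_conj. Qed.

Lemma vinv_density : vinv Q = dpow (- 1).
Proof.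
rewrite dens_calcV; apply: eq_dens_calc => i.
apply: (mulfI (lt0r_neq0 (dens_eig_gt0 i))).
rewrite divff ?gt_eqF ?dens_eig_gt0 // -[X in X * _]rpow1 ?dens_eig_gt0 //.
by rewrite rpowD subrr rpow0.
Qed.

Lemma dens_calc_sandwich (f g f' g' : C -> C) (c d : C) x :
  (forall i j, f (@dens_eig R M i) * g (@dens_eig R M j) = c ->
     f' (@dens_eig R M i) * g' (@dens_eig R M j) = d) ->
  vmul (vmul (dens_calc M f) x) (dens_calc M g) = c *: x ->
  vmul (vmul (dens_calc M f') x) (dens_calc M g') = d *: x.
Proof.
move=> fg /(congr1 val) /=; rewrite !val_vmul !val_dens_calc => e.
apply: val_inj; rewrite /= !val_vmul !val_dens_calc.
exact: fcalc_sandwich e.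
Qed.

Lemma nablaE x : nabla M x = vmul (vmul (dpow 1) x) (dpow (- 1)).
Proof.
rewrite /nabla vinv_density dpow1.
rewrite (linfunE (F := fun x => vmul (vmul Q x) (dpow (- 1)))) // => k y z.
by rewrite linearP vmul_linearl.
Qed.

Definition dens_spec : seq C := undup [seq @dens_eig R M i | i : 'I_(vn_dim M)].
Definition dens_proj (l : C) : L2 M := dens_calc M (fun c => (c == l)%:R).

Lemma dens_proj_eigenl f l : vmul (dens_calc M f) (dens_proj l) = f l *: dens_proj l.
Proof.
rewrite dens_calcM dens_calcZ; apply: eq_dens_calc => i.
by case: eqP => [->|_]; rewrite ?mulr1 ?mulr0.
Qed.

Lemma dens_proj_eigenr f l : vmul (dens_proj l) (dens_calc M f) = f l *: dens_proj l.
Proof.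
by rewrite -dens_proj_eigenl !dens_calcM; apply: eq_dens_calc => i; rewrite mulrC.
Qed.

Lemma dens_proj_sum : vone M = \sum_(l <- dens_spec) dens_proj l.
Proof.
have dens_calcP (s : seq C) :
    \sum_(l <- s) dens_proj l =
    dens_calc M (fun c => \sum_(l <- s) (c == l)%:R).
  elim: s => [|l s IH].
    rewrite big_nil; apply: val_inj; rewrite /= val_dens_calc.
    rewrite fcalc.unlock -[LHS](specmx0 (vsval Q)); congr specmx.
    by apply/rowP => i; rewrite !mxE big_nil.
  rewrite big_cons IH; apply: val_inj; rewrite /= !val_dens_calc.
  rewrite !fcalc.unlock -[X in X + _]scale1r -specmx_linear; congr specmx.
  by apply/rowP => i; rewrite !mxE big_cons mul1r.
rewrite dens_calcP -dens_calc1; apply: eq_dens_calc => i.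
rewrite (bigD1_seq (@dens_eig R M i)) ?undup_uniq //=; last first.
  by rewrite mem_undup; apply: map_f; rewrite mem_enum.
by rewrite eqxx big1 ?addr0 // => l; rewrite eq_sym => /negbTE ->.
Qed.

Lemma density_powE r : density_pow M r%:C = dpow r.
Proof.
rewrite /density_pow (opow_unique (S := lmul (dpow r)) (I := C) (l := id)).
- by rewrite lmulE vmul1.
- move=> c v; rewrite !lmulE cpow_real => Qv.
  have := @dens_calc_sandwich id (fun=> 1) (rpow r) (fun=> 1) c (rpow r c) v.
  rewrite dens_calc1 dens_calc_id !vmul1; apply => // i j.
  by rewrite !mulr1 => ->.
move=> v; exists dens_spec, (fun l => vmul (dens_proj l) v); split.
  by rewrite -vmul_suml -dens_proj_sum v1mul.
by move=> l; rewrite lmulE vmulA -{1}dens_calc_id dens_proj_eigenl vmulZl.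
Qed.

(** If p and q are spectral projections of Q for the eigenvalues a and b, then
p v q is an eigenvector of nabla for a / b. *)
Lemma opow_nabla r : opow (nabla M) r%:C = (lmul (dpow r) \o rmul (dpow (- r)))%VF.
Proof.
apply: (@opow_unique _ _ _ _ _ (C * C) (fun l => rpow 1 l.1 * rpow (- 1) l.2)).
  move=> c v; rewrite cpow_real comp_lfunE lmulE rmulE nablaE vmulA.
  apply: dens_calc_sandwich => i j <-.
  rewrite -!rpow_div ?dens_eig_gt0 // [rpow 1 _]rpow1 //.
  by rewrite divr_gt0 // dens_eig_gt0.
move=> v; exists [seq (l, l') | l <- dens_spec, l' <- dens_spec].
exists (fun l => vmul (vmul (dens_proj l.1) v) (dens_proj l.2)); split.
  rewrite big_allpairs -{1}(vmul1 v) -{1}(v1mul v) {1 2}dens_proj_sum !vmul_suml.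
  by apply: eq_bigr => l _; rewrite vmul_sumr.
case=> l l' /=; rewrite nablaE !vmulA dens_proj_eigenl -!vmulA dens_proj_eigenr.
by rewrite !vmulZr vmulZl !vmulA scalerA mulrC.
Qed.

Lemma nabla_quarter_sqr :
  (opow (nabla M) (4^-1)%R \o opow (nabla M) (4^-1)%R)%VF =
  (lmul (dpow 2^-1) \o rmul (dpow (- 2^-1)))%VF.
Proof.
have -> : (4^-1)%R = (4^-1 : R)%:C by rewrite fmorphV rmorph_nat.
have q2 : 4^-1 + 4^-1 = 2^-1 :> R.
  by rewrite [RHS]splitr -invfM -natrM.
apply/lfunP => v; rewrite opow_nabla !comp_lfunE !lmulE !rmulE !vmulA dpowD q2.
by rewrite -!vmulA dpowD -opprD q2.
Qed.

Lemma modaut_half y : modaut ('i / 2) y = vmul (vmul (dpow (- 2^-1)) y) (dpow 2^-1).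
Proof.
have e : 'i * ('i / 2) = (- 2^-1 : R)%:C.
  rewrite mulrA -expr2 sqr_i mulN1r rmorphN fmorphV rmorph_nat //.
by rewrite /modaut e -rmorphN opprK !density_powE.
Qed.

End DensityPowers.

(** * Images of sums of rank one operators *)

Section KrausImage.
Variables (R : realType) (M N : wvnAlg R).
Implicit Types (A : 'Hom(L2 M, L2 N)) (f : seq (L2 M)).
Local Notation C := R[i].

Lemma ketbra_decomp A f : parseval f ->
  A = \sum_(g <- f) ketbra (A g) g.
Proof.
move=> sf; apply/lfunP => y; rewrite sum_lfunE [in LHS](sf y) linear_sum.
by apply: eq_bigr => g _; rewrite ketbraE linearZ.
Qed.

(** The Hilbert-Schmidt inner product, computed in [f]. *)
Definition hs f (v T : 'Hom(L2 M, L2 N)) : C := \sum_(g <- f) ip (v g) (T g).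

Lemma hs_sumr f v I (r : seq I) (F : I -> 'Hom(L2 M, L2 N)) (c : I -> C) :
  hs f v (\sum_(i <- r) c i *: F i) = \sum_(i <- r) c i * hs f v (F i).
Proof.
rewrite /hs; under [RHS]eq_bigr => i _ do rewrite mulr_sumr.
rewrite [RHS]exchange_big; apply: eq_bigr => g _ /=.
rewrite sum_lfunE ip_sumr; apply: eq_bigr => i _.
by rewrite scale_lfunE ipZr.
Qed.

Lemma hs_conj f v w : (hs f v w)^* = hs f w v.
Proof. by rewrite /hs rmorph_sum; apply: eq_bigr => g _; exact: ip_conj. Qed.

Lemma hs_eq0 f v : parseval f -> hs f v v = 0 -> v = 0.
Proof.
move=> sf /eqP; rewrite psumr_eq0 => [/allP v0|g _]; last exact: ip_ge0.
apply/lfunP => x; rewrite zero_lfunE (sf x) linear_sum big_seq big1 // => g gf.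
by rewrite linearZ; have /eqP/ip_eq0 /= -> := v0 g gf; rewrite scaler0.
Qed.

(** Here X is the sum of the |v><v| for the Hilbert-Schmidt inner product.  If
X w = 0 then 0 = <w, X w> is the sum of the |<v, w>|^2, so w is orthogonal to all
v.  Hence X is injective on the span of the v, which it preserves, and by
dimension it maps this span onto itself. *)
Lemma limg_rank_one_sum (X : 'End('Hom(L2 M, L2 N))) (s : seq 'Hom(L2 M, L2 N)) :
  (forall x y, X (ketbra x y) = \sum_(v <- s) ip (v y) x *: v) ->
  limg X = <<s>>%VS.
Proof.
move=> XE; have [f [_ [_ sf]]] := onb M.
have XT T : X T = \sum_(v <- s) hs f v T *: v.
  rewrite [in LHS](ketbra_decomp T sf) linear_sum /=.
  under eq_bigr => g _ do rewrite XE.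
  by rewrite exchange_big; apply: eq_bigr => v _; rewrite -scaler_suml.
have Xs T : X T \in <<s>>%VS.
  by rewrite XT big_seq memv_suml // => v vs; rewrite memvZ ?memv_span.
have kerX : (<<s>> :&: lker X)%VS = 0%VS.
  apply/eqP; rewrite -subv0; apply/subvP => w; rewrite memv_cap memv_ker memv0.
  move=> /andP[ws /eqP Xw]; apply/eqP/(hs_eq0 sf).
  have : hs f w (X w) = 0.
    by rewrite Xw /hs big1 // => g _; rewrite zero_lfunE -(scale0r 0) ipZr mul0r.
  rewrite XT hs_sumr => /eqP; rewrite psumr_eq0 => [/allP hs0|v _]; last first.
    by rewrite -(hs_conj f v w) -normCK exprn_ge0.
  have {}hs0 v : v \in s -> hs f w v = 0.
    move=> /hs0 /=; rewrite -(hs_conj f v w) -normCK sqrf_eq0 normr_eq0.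
    by move=> /eqP ->; rewrite conjC0.
  have wE : w = \sum_i coord (in_tuple s) i w *: s`_i.
    exact: (@coord_span _ _ _ (in_tuple s)).
  rewrite [X in hs f w X = _]wE hs_sumr big1 // => i _.
  by rewrite hs0 ?mulr0 // mem_nth.
apply/eqP; rewrite eqEsubv; apply/andP; split.
  by apply/subvP => _ /memv_imgP[T _ ->].
suff -> : <<s>>%VS = (X @: <<s>>)%VS by exact: limgS (subvf _).
apply/esym/eqP; rewrite eqEdim (limg_dim_eq kerX) leqnn andbT.
by apply/subvP => _ /memv_imgP[T _ ->].
Qed.

End KrausImage.

(** * The action of Psi' A *)

(** The operator nabla^{-1/2}, which is also sigma_{i/2}. *)
HB.lock Definition nabla_halfV (R : realType) (M : wvnAlg R) : 'End(L2 M) :=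
  (lmul (dpow M (- 2^-1)) \o rmul (dpow M 2^-1))%VF.

Section ModularTwist.
Variables (R : realType) (M : wvnAlg R).
Implicit Types x y z : L2 M.
Local Notation Tr := (@markov_trace R M).
Local Notation h := (dpow M 2^-1).
Local Notation hV := (dpow M (- 2^-1)).

Lemma nabla_halfVE y : nabla_halfV M y = vmul (vmul hV y) h.
Proof. by rewrite nabla_halfV.unlock comp_lfunE lmulE rmulE vmulA. Qed.

Lemma dpow_half_sqr : vmul h h = density M.
Proof. by rewrite dpowD -[2^-1]div1r -splitr dpow1. Qed.

Lemma dpow_halfVl : vmul hV h = vone M.
Proof. by rewrite dpowD addNr dpow0. Qed.

Lemma dpow_halfVr : vmul h hV = vone M.
Proof. by rewrite dpowD subrr dpow0. Qed.

Lemma ipE x y : ip x y = Tr (vmul (vmul (density M) (vstar x)) y).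
Proof. by rewrite /ip densityE vmulA. Qed.

(** For q = Q, r = Q^{1/2} and rV = Q^{-1/2} this is [nabla_halfV_ip] written
with the Markov trace. *)
Lemma markov_trace_regroup (q r rV a b y : L2 M) :
  vmul r r = q -> vmul rV q = r ->
  Tr (vmul (vmul q a) (vmul (vmul r (vmul b rV)) y)) =
  Tr (vmul (vmul q b) (vmul (vmul (vmul rV y) r) (vmul r (vmul a rV)))).
Proof.
move=> rr rVq.
transitivity (Tr (vmul (vmul q a) (vmul (vmul r b) (vmul rV y)))); first by rewrite !vmulA.
transitivity (Tr (vmul (vmul (vmul q b) (vmul rV y)) (vmul (vmul q a) rV))); last first.
  by rewrite -rr !vmulA.
by rewrite [in RHS]vmulA [RHS]markov_traceC [LHS]markov_traceC -[in LHS]rVq !vmulA.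
Qed.

(** It says that sigma(y) sigma(x)^* has the coefficients
<x, sigma_{i/2}(g)^* y> in an orthonormal basis of vectors g. *)
Lemma nabla_halfV_ip (g x y : L2 M) :
  ip x (vmul (vstar (modaut ('i%C / 2) g)) y) =
  ip g (vmul (nabla_halfV M y) (vstar (nabla_halfV M x))).
Proof.
rewrite modaut_half !nabla_halfVE !vstarM !dpow_star !ipE.
apply: markov_trace_regroup; first exact: dpow_half_sqr.
by rewrite -dpow_half_sqr vmulA dpow_halfVl v1mul.
Qed.

(** For an orthonormal basis of vectors g, the elements g h are orthonormal for
the Markov trace.  Pairing the sum of the g Q g^* with w gives the trace, in
B(L2 M), of the left multiplication by Q w^*, which is the Markov trace of
Q w^*. *)
Lemma onb_resolution (f : seq (L2 M)) : parseval f ->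
  \sum_(g <- f) vmul (vmul g h) (vstar (vmul g h)) = vone M.
Proof.
move=> sf; apply/eqP; rewrite -subr_eq0; apply/eqP.
set w := _ - _; apply: ip_eq0; rewrite {2}/w -scaleN1r ipDr ipZr mulN1r.
apply/eqP; rewrite subr_eq0; apply/eqP.
rewrite ip_sumr [RHS]ipE vmul1 [RHS](optraceE _ sf); apply: eq_bigr => g _.
have ghg : vmul (vmul g h) (vstar (vmul g h)) = vmul g (vmul (density M) (vstar g)).
  by rewrite vstarM dpow_star -vmulA [vmul h (vmul h _)]vmulA dpow_half_sqr.
by rewrite lmulE ghg !ipE [in LHS]vmulA markov_traceC.
Qed.

End ModularTwist.

Section Kraus.
Variables (R : realType) (M N : wvnAlg R) (A : 'Hom(L2 M, L2 N)).
Local Notation act := (optens_act (Psi' A)).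

(** Writing A as the sum of the |A(g)><g|, the operators A(g) are weighted by the
coefficients of sigma(z) sigma(y)^* in the basis. *)
Lemma act_ketbra x y z :
  act (ketbra x y) z = vmul (A (vmul (nabla_halfV M z) (vstar (nabla_halfV M y)))) x.
Proof.
have [f [_ [_ sf]]] := onb M.
rewrite {1}(ketbra_decomp A sf) !linear_sum !sum_lfunE.
rewrite [X in A X](sf (vmul _ _)) linear_sum vmul_suml; apply: eq_bigr => g _ /=.
rewrite Psi'E optens_actE !comp_lfunE !lmulE ketbraE nabla_halfV_ip.
by rewrite vmulZr [A (_ *: _)]linearZ /= vmulZl.
Qed.

(** When [s] factors [A] and [f] is an orthonormal basis, Psi'(A) acts as the sum
of the |v><v| over these maps v. *)
Definition kraus (s : seq 'Hom(L2 M, L2 N)) (f : seq (L2 N)) : seq 'Hom(L2 M, L2 N) :=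
  [seq (rmul e \o D \o nabla_halfV M)%VF | D <- s, e <- f].

Lemma limg_act s f : gram_factors A s -> parseval f ->
  limg act = <<kraus s f>>%VS.
Proof.
move=> As sf; apply: limg_rank_one_sum => x y; apply/lfunP => z.
rewrite act_ketbra As vmul_suml sum_lfunE big_allpairs_dep; apply: eq_bigr => D _.
rewrite -vmulA [vmul (vstar _) x]sf vmul_sumr; apply: eq_bigr => e _.
by rewrite scale_lfunE !comp_lfunE !rmulE vmulZr ip_lmul vstarK.
Qed.

End Kraus.

(** * Composition of quantum relations *)

(** The operator nabla^{1/2}. *)
HB.lock Definition nabla_half (R : realType) (M : wvnAlg R) : 'End(L2 M) :=
  (lmul (dpow M 2^-1) \o rmul (dpow M (- 2^-1)))%VF.

Section Composition.
Variables (R : realType) (M1 M2 M3 : wvnAlg R).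
Variables (A1 : 'Hom(L2 M1, L2 M2)) (A2 : 'Hom(L2 M2, L2 M3)).
Local Notation h := (dpow M2 2^-1).
Local Notation act1 := (optens_act (Psi' A1)).
Local Notation act2 := (optens_act (Psi' A2)).
Local Notation act := (optens_act (Psi' (A2 \o A1)%VF)).

Lemma nabla_halfK (M : wvnAlg R) x : nabla_halfV M (nabla_half M x) = x.
Proof.
rewrite nabla_halfVE nabla_half.unlock comp_lfunE lmulE rmulE !vmulA dpow_halfVl v1mul.
by rewrite -vmulA dpow_halfVl vmul1.
Qed.

(** The span of [kraus s f] does not depend on [f], as it contains the vectors of
every element [e]. *)
Lemma kraus_mem (M N : wvnAlg R) (s : seq 'Hom(L2 M, L2 N)) f D e :
  parseval f -> D \in s ->
  (rmul e \o D \o nabla_halfV M)%VF \in <<kraus s f>>%VS.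
Proof.
move=> sf Ds.
have -> : (rmul e \o D \o nabla_halfV M)%VF =
    \sum_(g <- f) ip g e *: (rmul g \o D \o nabla_halfV M)%VF.
  apply/lfunP => y; rewrite sum_lfunE !comp_lfunE rmulE [in LHS](sf e) vmul_sumr.
  by apply: eq_bigr => g _; rewrite scale_lfunE !comp_lfunE rmulE vmulZr.
rewrite big_seq memv_suml // => g gf; rewrite memvZ // memv_span //.
exact: allpairs_f.
Qed.

(** Inserting the resolution of 1 by the (g h) (g h)^* between D(x) and D(y)^*
gives new factors of the same map. *)
Definition markov_rescale (s : seq 'Hom(L2 M1, L2 M2)) (f : seq (L2 M2)) :=
  [seq (rmul (vmul g h) \o D)%VF | D <- s, g <- f].

Lemma gram_factors_markov_rescale s f : parseval f ->
  gram_factors A1 s -> gram_factors A1 (markov_rescale s f).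
Proof.
move=> sf As x y; rewrite As big_allpairs_dep; apply: eq_bigr => D _.
rewrite -[D x in LHS]vmul1 -(onb_resolution sf) vmul_sumr vmul_suml.
by apply: eq_bigr => g _; rewrite !comp_lfunE !rmulE !vstarM !vmulA.
Qed.

Lemma gram_factors_comp s1 s2 : gram_factors A1 s1 -> gram_factors A2 s2 ->
  gram_factors (A2 \o A1)%VF [seq (E \o D)%VF | E <- s2, D <- s1].
Proof.
move=> As1 As2 x y; rewrite comp_lfunE As1 linear_sum big_allpairs_dep.
rewrite [RHS]exchange_big; apply: eq_bigr => D _.
by rewrite [LHS]As2; apply: eq_bigr => E _; rewrite !comp_lfunE.
Qed.

Lemma span_comp (W : {vspace 'Hom(L2 M1, L2 M3)}) (X : seq 'Hom(L2 M2, L2 M3)) m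
    (Y : seq 'Hom(L2 M1, L2 M2)) :
  (forall u v, u \in X -> v \in Y -> (u \o m \o v)%VF \in W) ->
  forall u v, u \in <<X>>%VS -> v \in <<Y>>%VS -> (u \o m \o v)%VF \in W.
Proof.
move=> XY u v uX vY.
have -> : (u \o m \o v)%VF = \sum_i \sum_j
    (coord (in_tuple X) i u * coord (in_tuple Y) j v) *: (X`_i \o m \o Y`_j)%VF.
  apply/lfunP => y.
  rewrite {1}(@coord_span _ _ _ (in_tuple X) _ uX) {1}(@coord_span _ _ _ (in_tuple Y) _ vY).
  rewrite !comp_lfunE !sum_lfunE; apply: eq_bigr => i _.
  rewrite sum_lfunE linear_sum scale_lfunE linear_sum scaler_sumr; apply: eq_bigr => j _ /=.
  by rewrite !scale_lfunE !comp_lfunE [m (_ *: _)]linearZ /= [X`_i (_ *: _)]linearZ /= scalerA.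
by apply: memv_suml => i _; apply: memv_suml => j _; rewrite memvZ // XY // mem_nth.
Qed.

(** The image for A2 A1 is the span of the products u nabla^{1/2} v, stated as an
inclusion and a universal property.  Both parts compare the vectors
z |-> E(D(sigma z) g h) e' of A2 A1 with the products of the vectors
z |-> E(sigma z) e' of A2 and z |-> D(sigma z) e of A1. *)
Lemma limg_act_comp (s1 : seq 'Hom(L2 M1, L2 M2)) (s2 : seq 'Hom(L2 M2, L2 M3)) :
  gram_factors A1 s1 -> gram_factors A2 s2 ->
  (forall u v, u \in limg act2 -> v \in limg act1 -> (u \o nabla_half M2 \o v)%VF \in limg act) /\
  (forall W : {vspace 'Hom(L2 M1, L2 M3)},
     (forall u v, u \in limg act2 -> v \in limg act1 -> (u \o nabla_half M2 \o v)%VF \in W) ->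
     (limg act <= W)%VS).
Proof.
move=> As1 As2; have [f2 [_ [_ sf2]]] := onb M2; have [f3 [_ [_ sf3]]] := onb M3.
have Ars := gram_factors_markov_rescale sf2 As1; have As := gram_factors_comp Ars As2.
rewrite (limg_act As sf3) (limg_act As1 sf2) (limg_act As2 sf3); split.
  apply: span_comp => _ _ /allpairsP[[E e'] /= [Es e'f ->]] /allpairsP[[D e] /= [Ds ef ->]].
  (* Expand e h^{-1} in the orthonormal basis, so that e is a combination of the
     elements g h. *)
  have -> : (rmul e' \o E \o nabla_halfV M2 \o nabla_half M2 \o
      (rmul e \o D \o nabla_halfV M1))%VF =
     \sum_(g <- f2) ip g (vmul e (dpow M2 (- 2^-1))) *:
       (rmul e' \o (E \o (rmul (vmul g h) \o D)) \o nabla_halfV M1)%VF.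
    apply/lfunP => y; rewrite sum_lfunE !comp_lfunE nabla_halfK !rmulE.
    rewrite -[e in LHS]vmul1 -(dpow_halfVl M2) [vmul e (vmul _ _)]vmulA.
    rewrite [vmul e _ in LHS]sf2 vmul_suml vmul_sumr linear_sum vmul_suml.
    apply: eq_bigr => g _; rewrite scale_lfunE !comp_lfunE !rmulE.
    by rewrite vmulZl vmulZr linearZ vmulZl.
  rewrite big_seq memv_suml // => g gf; rewrite memvZ //.
  apply: kraus_mem sf3 _; apply: allpairs_f => //; exact: allpairs_f.
move=> W inW; apply/span_subvP => _ /allpairsP[[E0 e'] /= [+ e'f ->]].
move=> /allpairsP[[E D0] /= [Es + ->]] => /allpairsP[[D g] /= [Ds gf ->]].
have -> : (rmul e' \o (E \o (rmul (vmul g h) \o D)) \o nabla_halfV M1)%VF =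
    (rmul e' \o E \o nabla_halfV M2 \o nabla_half M2 \o
      (rmul (vmul g h) \o D \o nabla_halfV M1))%VF.
  by apply/lfunP => y; rewrite !comp_lfunE nabla_halfK.
by apply: inW; apply: kraus_mem.
Qed.

End Composition.

Lemma qrel_ofP (R : realType) (M N : wvnAlg R) (x : subvs_of (optens N M))
    (w : 'Hom(L2 M, L2 N)) : reflect
  (exists2 T, T \in optens_im x &
     w = (opow (nabla N) (4^-1)%R \o T \o opow (nabla M) (4^-1)%R)%VF)
  (w \in qrel_of x).
Proof.
have lin : linear (fun T : 'Hom(L2 M, L2 N) =>
    opow (nabla N) (4^-1)%R \o T \o opow (nabla M) (4^-1)%R)%VF.
  by move=> k S T; rewrite comp_lfunDr comp_lfunDl -comp_lfunZr -comp_lfunZl.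
apply: (iffP memv_imgP) => -[T Tx ->]; exists T => //; by rewrite (linfunE lin).
Qed.

Lemma qrel_comp_Psi' (R : realType) (M1 M2 M3 : wvnAlg R)
    (A1 : 'Hom(L2 M1, L2 M2)) (A2 : 'Hom(L2 M2, L2 M3)) :
  completely_positive A1 -> completely_positive A2 ->
  qrel_comp (qrel_of (Psi' A2)) (qrel_of (Psi' A1)) = qrel_of (Psi' (A2 \o A1)%VF).
Proof.
move=> /cp_gram_factors[s1 As1] /cp_gram_factors[s2 As2].
have [compI compW] := limg_act_comp As1 As2.
have sandwich_comp (u : 'Hom(L2 M2, L2 M3)) (v : 'Hom(L2 M1, L2 M2)) :
   ((opow (nabla M3) (4^-1)%R \o u \o opow (nabla M2) (4^-1)%R) \o
   (opow (nabla M2) (4^-1)%R \o v \o opow (nabla M1) (4^-1)%R) =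
   opow (nabla M3) (4^-1)%R \o (u \o nabla_half M2 \o v) \o opow (nabla M1) (4^-1)%R)%VF.
  by rewrite nabla_half.unlock -nabla_quarter_sqr !comp_lfunA.
apply/vspaceP => w; apply/idP/idP.
  move=> /qrel_compP[s [/allP sV ->]]; rewrite big_seq; apply: memv_suml => -[p1 p2] /sV /andP[/=].
  move=> /qrel_ofP[u uI ->] /qrel_ofP[v vI ->]; rewrite sandwich_comp.
  by apply/qrel_ofP; exists (u \o nabla_half M2 \o v)%VF => //; exact: compI.
move=> /qrel_ofP[T TI ->].
pose F (S : 'Hom(L2 M1, L2 M3)) :=
  (opow (nabla M3) (4^-1)%R \o S \o opow (nabla M1) (4^-1)%R)%VF.
have linF : linear F.
  by move=> k S U; rewrite /F comp_lfunDr comp_lfunDl -comp_lfunZr -comp_lfunZl.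
rewrite -[X in X \in _]/(F T) -(linfunE linF) memv_preim.
apply: (subvP (compW _ _)) TI => u v uI vI; rewrite -memv_preim (linfunE linF).
apply/qrel_compP; exists [:: ((opow (nabla M3) (4^-1)%R \o u \o opow (nabla M2) (4^-1)%R)%VF,
   (opow (nabla M2) (4^-1)%R \o v \o opow (nabla M1) (4^-1)%R)%VF)].
rewrite big_seq1 /= sandwich_comp andbT; split=> //.
by apply/andP; split; apply/qrel_ofP; [exists u|exists v].
Qed.

(** * Positivity of Psi' A *)

Section ChoiMatrix.
Variables (R : realType) (M N : wvnAlg R).
Local Notation C := R[i].
Local Notation Tr := (@markov_trace R M).
Local Notation h := (dpow M 2^-1).
Local Notation hV := (dpow M (- 2^-1)).

(** A nonzero column of the spectral projection for an eigenvalue l is a vector y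
over M with X y = l y, on which the GNS quadratic form has the sign of l. *)
Lemma psdmx_block_ip d (X : 'M[L2 M]_d) : (blockmx X)^t* = blockmx X ->
  (forall y : 'I_d -> L2 M, 0 <= \sum_s \sum_t ip (y s) (vmul (X s t) (y t))) ->
  psdmx (blockmx X).
Proof.
move=> hX X_ge0; have nX := selfadj_normalmx hX.
apply: psdmx_spectral => // i.
have [Y YE] := blockmx_fcalc (fun c => (c == spectral_diag (blockmx X) 0 i)%:R) nX.
have XY := specproj_eigen i nX; have := specproj_neq0 (blockmx X) i.
rewrite /specproj YE in XY *; set l := spectral_diag _ _ _ in XY *.
move=> Y0; have [u [s0 Yu]] : exists u s, Y s u != 0.
  apply: contrapT => Yu; case/negP: Y0; apply/eqP/mxblockP => s t.
  rewrite mxblockK submxblock0; have -> : Y s t = 0.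
    by apply/eqP; apply: contrapT => /negP Yst; apply: Yu; exists t, s.
  by rewrite linear0.
have XYu s : \sum_t vmul (X s t) (Y t u) = l *: Y s u.
  have := congr1 (fun B => submxblock B s u) XY; rewrite blockmxM.
  have -> : l *: blockmx Y = blockmx (\matrix_(i, j) (l *: Y i j)).
    by apply/matrixP => r c; rewrite !mxE.
  rewrite !mxblockK !mxE => e; exact: val_inj e.
have := X_ge0 (fun s => Y s u).
under eq_bigr => s _ do rewrite -ip_sumr XYu ipZr.
rewrite -mulr_sumr pmulr_lge0 //.
rewrite (bigD1 s0) //= ltr_pwDl ?sumr_ge0 // => [|s _]; last exact: ip_ge0.
rewrite lt_neqAle ip_ge0 andbT eq_sym.
by apply: contra Yu => /eqP/ip_eq0 ->.
Qed.

Lemma markov_trace_cycle (q qV a e y : L2 M) : vmul q qV = vone M ->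
  Tr (vmul (vmul q a) (vmul e y)) =
  Tr (vmul (vmul q (vmul (vmul qV (vmul y q)) a)) e).
Proof. by move=> qqV; rewrite [in LHS]vmulA [LHS]markov_traceC !vmulA qqV v1mul. Qed.

(** The adjoint of the right multiplication by y is the right multiplication by
Q y^* Q^{-1}. *)
Lemma ip_vmulr (x e y : L2 M) :
  ip x (vmul e y) = ip (vmul x (vmul (vmul (density M) (vstar y)) (dpow M (- 1)))) e.
Proof.
rewrite !ipE !vstarM vstarK density_herm dpow_star; apply: markov_trace_cycle.
by rewrite -dpow1 dpow_opp.
Qed.

Lemma ip_inj (a b : L2 M) : (forall x, ip x a = ip x b) -> a = b.
Proof.
move=> ab; apply/eqP; rewrite -subr_eq0; apply/eqP/ip_eq0.
by rewrite -scaleN1r ipDr ipZr ab mulN1r subrr.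
Qed.

Definition modstar (x : L2 M) : L2 M := vmul (vmul h (vstar x)) hV.

Lemma vstar_modaut_halfE x : vstar (modaut ('i%C / 2) x) = modstar x.
Proof. by rewrite modaut_half !vstarM !dpow_star /modstar vmulA. Qed.

Lemma modstar_antilinear k x y :
  modstar (k *: x + y) = k^* *: modstar x + modstar y.
Proof. by rewrite /modstar vstarD vstarZ linearP vmulDl vmulZl. Qed.

Lemma half_dpowN1 : vmul h (dpow M (- 1)) = hV.
Proof.
rewrite dpowD; congr dpow.
by rewrite [X in _ - X](splitr 1) div1r opprD addrA subrr add0r.
Qed.

Lemma density_halfN : vmul (density M) hV = h.
Proof. by rewrite -dpow_half_sqr -vmulA dpow_halfVr vmul1. Qed.

Lemma sandwich_absorb (r rV q qV x : L2 M) : vmul r qV = rV -> vmul q rV = r ->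
  vmul (vmul r (vmul qV (vmul x q))) rV = vmul rV (vmul x r).
Proof. by move=> rqV qrV; rewrite vmulA rqV -!vmulA qrV. Qed.

Lemma sandwich_split (r rV q qV a b : L2 M) : vmul r qV = rV -> vmul r r = q ->
  vmul (vmul r (vmul (vmul qV (vmul a q)) b)) rV =
  vmul (vmul (vmul rV a) r) (vmul r (vmul b rV)).
Proof. by move=> rqV rr; rewrite -rr -rqV !vmulA. Qed.

Section Basis.
Variable f : seq (L2 M).
Hypothesis sf : parseval f.

(** The element of M_m(M), for M acting on C^m, that is obtained from
Psi'(id), the sum of the g tensor (sigma_{i/2}(g)^* )^op, by reading the second
leg, realized as a transposed matrix, entry by entry. *)
Definition choi_block : 'M[L2 M]_(vn_dim M) :=
  \matrix_(s, t) \sum_(g <- f) vsval (modstar g) t s *: g.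

(** The right-hand side is antilinear in x, and x is expanded along [f]. *)
Lemma ip_choi_block x s t : ip x (choi_block s t) = vsval (modstar x) t s.
Proof.
have modstar_sum (r : seq (L2 M)) c : modstar (\sum_(g <- r) c g *: g) =
    \sum_(g <- r) (c g)^* *: modstar g.
  elim: r => [|g r IH]; last by rewrite !big_cons modstar_antilinear IH.
  by rewrite !big_nil /modstar -(scale0r 0) vstarZ rmorph0 vmulZr vmulZl !scale0r.
rewrite mxE ip_sumr [in RHS](sf x) modstar_sum linear_sum summxE.
by apply: eq_bigr => g _; rewrite ipZr ip_conj /= mxE mulrC.
Qed.

Lemma choi_block_star s t : vstar (choi_block s t) = choi_block t s.
Proof.
apply: ip_inj => x; rewrite ip_choi_block /ip -vstarM phi_star.
have := ip_vmulr (vone M) (choi_block s t) x; rewrite {1}/ip vstar1 v1mul => ->.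
rewrite v1mul ip_choi_block.
have -> : modstar (vmul (vmul (density M) (vstar x)) (dpow M (- 1))) =
    vstar (modstar x).
  rewrite /modstar !vstarM !vstarK density_herm !dpow_star.
  exact: sandwich_absorb half_dpowN1 density_halfN.
by rewrite val_vstar !mxE conjCK.
Qed.

(** The form at y is the sum over u of the |c_u|^2, with c_u the sum over t of
the entries (t, u) of the matrices nabla^{-1/2}(y_t). *)
Lemma choi_block_form (y : 'I_(vn_dim M) -> L2 M) :
  0 <= \sum_s \sum_t ip (y s) (vmul (choi_block s t) (y t)).
Proof.
have E s t : ip (y s) (vmul (choi_block s t) (y t)) =
    \sum_u vsval (nabla_halfV M (y t)) t u * (vsval (nabla_halfV M (y s)) s u)^*.
  rewrite ip_vmulr ip_choi_block.
  have -> : modstar (vmul (y s) (vmul (vmul (density M) (vstar (y t))) (dpow M (- 1)))) =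
      vmul (nabla_halfV M (y t)) (vstar (nabla_halfV M (y s))).
    rewrite !nabla_halfVE /modstar !vstarM !vstarK density_herm !dpow_star.
    by apply: sandwich_split; [exact: half_dpowN1|exact: dpow_half_sqr].
  by rewrite val_vmul val_vstar mxE; apply: eq_bigr => u _; rewrite !mxE.
under eq_bigr => s _ do under eq_bigr => t _ do rewrite E.
rewrite exchange_big /=; under eq_bigr => t _ do rewrite exchange_big /=.
rewrite exchange_big /=; apply: sumr_ge0 => u _.
under eq_bigr => t _ do rewrite -mulr_sumr.
by rewrite -mulr_suml -rmorph_sum -normCK exprn_ge0.
Qed.

Lemma choi_block_psd : psdmx (blockmx choi_block).
Proof.
apply: psdmx_block_ip; last exact: choi_block_form.
by rewrite blockmx_adj; congr blockmx; apply/matrixP => s t; rewrite mxE choi_block_star.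
Qed.

End Basis.

(** Applying [A] to the blocks of [choi_block] gives the matrix of Psi'(A) with
the two tensor legs exchanged. *)
Lemma Psi'_psd (A : 'Hom(L2 M, L2 N)) : completely_positive A -> psdmx (vsval (Psi' A)).
Proof.
move=> cpA; have [f [_ [_ sf]]] := onb M.
have psdA := cpA _ _ (choi_block_psd sf).
pose to_block (k : 'I_(vn_dim N * vn_dim M)) : 'I_(\sum_(s < vn_dim M) vn_dim N) :=
  tagnat.Rank (p_ := fun=> vn_dim N) (mxtens_unindex k).2 (mxtens_unindex k).1.
rewrite (_ : vsval _ = mxsub to_block to_block
   (\mxblock_(s < vn_dim M, t < vn_dim M) vsval (A (choi_block f s t)))).
  exact: psdmx_mxsub.
have entry s t i j : (\mxblock_(s < vn_dim M, t < vn_dim M) vsval (A (choi_block f s t)))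
    (tagnat.Rank s i) (tagnat.Rank t j) = vsval (A (choi_block f s t)) i j.
  have /matrixP/(_ i j) <- := mxblockK (p_ := fun=> vn_dim N) (q_ := fun=> vn_dim N)
    (fun s t : 'I_(vn_dim M) => vsval (A (choi_block f s t))) s t.
  by rewrite /submxblock [RHS]mxE.
apply/matrixP => k l; rewrite -[k]mxtens_unindexK -[l]mxtens_unindexK.
case: (mxtens_unindex k) (mxtens_unindex l) => [i s] [j t] /=.
rewrite [RHS]mxE /to_block !mxtens_indexK /= entry.
have -> : vsval (Psi' A) = \sum_(g <- f) vsval (A g) *t (vsval (modstar g))^T.
  rewrite {1}(ketbra_decomp A sf) !linear_sum; apply: eq_bigr => g _ /=.
  by rewrite Psi'E optensor_val vstar_modaut_halfE.
have -> : vsval (A (choi_block f s t)) = \sum_(g <- f) vsval (modstar g) t s *: vsval (A g).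
  rewrite [choi_block f s t]mxE !linear_sum; apply: eq_bigr => g _ /=.
  by rewrite !linearZ.
rewrite !summxE; apply: eq_bigr => g _.
by rewrite !mxE !mxtens_indexK /= mulrC.
Qed.

End ChoiMatrix.

Theorem proposition5p13 (R : realType) (M1 M2 M3 : wvnAlg R)
  (V1 : {vspace 'Hom(L2 M1, L2 M2)}) (V2 : {vspace 'Hom(L2 M2, L2 M3)})
  (A1 : 'Hom(L2 M1, L2 M2)) (A2 : 'Hom(L2 M2, L2 M3)) :
  quantum_relation V1 -> quantum_relation V2 ->
  completely_positive A1 -> completely_positive A2 ->
  V1 = qrel_of (Psi' A1) -> V2 = qrel_of (Psi' A2) ->
  psdmx (vsval (Psi' (A2 \o A1)%VF)) /\
  qrel_comp V2 V1 = qrel_of (Psi' (A2 \o A1)%VF).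
Proof.
move=> _ _ cpA1 cpA2 -> ->; split; last exact: qrel_comp_Psi'.
apply: Psi'_psd => k X /cpA1 psdA1.
have := cpA2 k (\matrix_(i, j) A1 (X i j)).
rewrite (_ : mxblock _ = \mxblock_(i < k, j < k) vsval (A1 (X i j))); last first.
  by apply: eq_mxblock => i j; rewrite mxE.
move=> /(_ psdA1).
rewrite (_ : mxblock _ = \mxblock_(i < k, j < k) vsval ((A2 \o A1)%VF (X i j))) //.
by apply: eq_mxblock => i j; rewrite mxE comp_lfunE.
Qed.
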